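(* Let $p$ be a prime, $\alpha\ge 1$ an integer and $N=p^\alpha$. Let $D\subset\mathbb{Z}_{\ge 0}$ be a nonempty finite set whose elements lie in pairwise different residue classes modulo $N$, let $\mu=\mu_{N,D}$ be the associated Cantor measure, and let $T=\{t>0:\Phi_{p^t}\mid P_D\}$, where $P_D(x)=\sum_{d\in D}x^d$. Assume $P_D=\prod_{t\in T}\Phi_{p^t}$. (i) If $\Lambda\subset\mathbb{R}$ is an orthogonal maximal set of frequencies for $\mu$ with $0\in\Lambda$, then there exists an $(N,D)$-spectral labeling $\mathcal{L}$ of the rooted $|D|$-homogeneous tree such that $\Lambda=\Lambda(\mathcal{L})$. (ii) Conversely, if $\mathcal{L}$ is an $(N,D)$-spectral labeling of the rooted $|D|$-homogeneous tree, then $\Lambda(\mathcal{L})$ is an orthogonal maximal set of frequencies for $\mu$ containing $0$.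
   Context: Cantor measure: $\mu=\mu_{N,D}$ is the unique Borel probability measure on $\mathbb{R}$ satisfying $\mu=\frac{1}{|D|}\sum_{d\in D}\mu\circ\phi_d^{-1}$, where $\phi_d(x)=N^{-1}(x+d)$. Cyclotomic polynomials: $\Phi_n$ denotes the $n$-th cyclotomic polynomial. $T$ is the set of positive integers $t$ such that $\Phi_{p^t}$ divides $P_D$. Exponentials: $e_\lambda(x)=e^{2\pi i\lambda x}$ and $E(\Lambda)=\{e_\lambda:\lambda\in\Lambda\}$. ''$E(\Lambda)$ is orthogonal in $L^2(\mu)$'' means $\int e_\lambda\overline{e_{\lambda'}}\,d\mu=0$ for all $\lambda\ne\lambda'$ in $\Lambda$. Maximality: $\Lambda\subset\mathbb{R}$ is an orthogonal maximal set of frequencies for $\mu$ if $E(\Lambda)$ is orthogonal in $L^2(\mu)$ and for every $\Lambda'\subset\mathbb{R}$ with $\Lambda\subset\Lambda'$ and $E(\Lambda')$ orthogonal in $L^2(\mu)$ one has $\Lambda'=\Lambda$. Hadamard triple: for finite sets $A,B\subset\mathbb{Z}$ with $|A|=|B|$, $(N,A,B)$ is a Hadamard triple if the matrix $\frac{1}{\sqrt{|A|}}\left(e^{2\pi i ab/N}\right)_{a\in A,\,b\in B}$ is unitary. Trees and labelings: in the rooted $|D|$-homogeneous tree every vertex has exactly $|D|$ children; a vertex at distance $n$ from the root has level (order) $n$. A labeling $\mathcal{L}$ assigns to each vertex other than the root a label in $\{0,\dots,N-1\}$. Infinite paths starting at a vertex are descending: each vertex of the path is followed by one of its children. The labels of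 an infinite path starting at the root form a sequence $(d_n)_{n\ge0}$, where $d_n$ is the label of the vertex of level $n+1$ on the path. A labeling is $(N,D)$-spectral if: (1) there is an infinite path starting at the root all of whose (non-root) vertices are labeled $0$; (2) for every vertex $v$ there is at least one infinite path starting from $v$ whose vertices are eventually all labeled $0$ or eventually all labeled $N-1$; (3) for every vertex $v$, if $L_v$ denotes the set of labels of the children of $v$, then $(N,D,L_v)$ is a Hadamard triple (in particular $|L_v|=|D|$). The set $\Lambda(\mathcal{L})$: to an infinite path from the root with label sequence $(d_n)_{n\ge0}$ that is eventually $0$ associate the integer $\sum_{n\ge0}d_nN^n$; to one with $d_n=N-1$ for all $n\ge n_0$ associate the integer $\sum_{n=0}^{n_0-1}d_nN^n-N^{n_0}$ (independent of the choice of $n_0$). $\Lambda(\mathcal{L})\subset\mathbb{Z}$ is the set of all integers so obtained. *)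

(* Defs.v *)
From mathcomp Require Import all_boot all_order all_algebra all_field.
From mathcomp Require Import finmap.
From mathcomp Require Import spectral complex.
From mathcomp Require Import all_classical all_reals all_analysis.

Set Implicit Arguments.
Unset Strict Implicit.
Unset Printing Implicit Defensive.

Import Order.TTheory GRing.Theory Num.Theory.
Import numFieldNormedType.Exports.

Local Open Scope fset_scope.
Local Open Scope classical_set_scope.
Local Open Scope ring_scope.

(* e^{2 pi i t}, by Euler's formula *)
Definition cis {R : realType} (t : R) : R[i] :=
  Complex (cos (2 * pi * t)) (sin (2 * pi * t)).

Definition freq {R : realType} (lambda x : R) : R[i] := cis (lambda * x).

Definition cintegral {R : realType} (mu : probability (measurableTypeR R) R)
    (f : R -> R[i]) : R[i] :=
  Complex (Rintegral mu setT (fun x => complex.Re (f x)))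
          (Rintegral mu setT (fun x => complex.Im (f x))).

Definition phi {R : realType} (N d : nat) : measurableTypeR R -> measurableTypeR R :=
  fun x => N%:R^-1 * (x + d%:R).

Definition is_cantor_measure {R : realType} (N : nat) (D : {fset nat})
    (mu : probability (measurableTypeR R) R) : Prop :=
  forall A : set (measurableTypeR R), measurable A ->
    mu A = ((#|` D|%:R^-1)%:E * \sum_(d <- D) pushforward mu (phi N d) A)%E.

Definition mask_poly (D : {fset nat}) : {poly int} := \sum_(d <- D) 'X^d.

(* 'Phi_n is monic, so divisibility in the sense of polydiv agrees with
   divisibility in Z[x] (and in Q[x]). *)
Definition cyclotomic_exponents (p : nat) (D : {fset nat}) : set nat :=
  [set t | (0 < t)%N /\ 'Phi_(p ^ t) %| mask_poly D].

Definition orthogonal_freqs {R : realType}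
    (mu : probability (measurableTypeR R) R) (Lambda : set R) : Prop :=
  forall l l' : R, Lambda l -> Lambda l' -> l <> l' ->
    cintegral mu (fun x => freq l x * (freq l' x)^*) = 0.

Definition orthogonal_maximal {R : realType}
    (mu : probability (measurableTypeR R) R) (Lambda : set R) : Prop :=
  orthogonal_freqs mu Lambda /\
  forall Lambda' : set R,
    Lambda `<=` Lambda' -> orthogonal_freqs mu Lambda' -> Lambda' = Lambda.

Definition hadamard_mx (R : realType) (N : nat) (A B : {fset int}) :
    'M[R[i]]_(#|` A|, #|` B|) :=
  (sqrtC #|` A|%:R)^-1 *:
    \matrix_(i, j) cis (((enum_fset A)`_i)%:~R * ((enum_fset B)`_j)%:~R / N%:R).

Definition hadamard_triple (R : realType) (N : nat) (A B : {fset int}) : Prop :=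
  #|` A| = #|` B| /\ hadamard_mx R N A B \is unitarymx.

(* Vertices of the rooted q-homogeneous tree are words over 'I_q: the root is
   [::] and the children of v are the words rcons v i. A non-root vertex
   rcons v i is given by the pair (v, i), so a labeling, which is defined on
   the non-root vertices with labels in {0, ..., N - 1}, takes v and i. *)
Definition labeling (N q : nat) := seq 'I_q -> 'I_q -> 'I_N.

(* A descending infinite path from v is given by its successive choices of
   children f : nat -> 'I_q; its n-th vertex is v followed by f 0, ..., f n.-1.
   path_label L v f n is the label of the vertex reached after n.+1 steps. *)
Definition path_label (N q : nat) (L : labeling N q) (v : seq 'I_q)
    (f : nat -> 'I_q) (n : nat) : nat :=
  L (v ++ mkseq f n) (f n).

Definition eventually_eq (d : nat -> nat) (c : nat) : Prop :=
  exists n0, forall n, (n0 <= n)%N -> d n = c.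

Definition child_labels (N q : nat) (L : labeling N q) (v : seq 'I_q) :
    {fset int} :=
  [fset Posz (L v i) | i in 'I_q]%fset.

Definition spectral_labeling (R : realType) (N : nat) (D : {fset nat})
    (L : labeling N #|` D|) : Prop :=
  [/\ exists f, forall n, path_label L [::] f n = 0%N,
      forall v, exists f, eventually_eq (path_label L v f) 0 \/
                          eventually_eq (path_label L v f) N.-1
    & forall v, hadamard_triple R N [fset Posz d | d in D]%fset
                                    (child_labels L v)].

Definition digits_value (N : nat) (d : nat -> nat) (z : int) : Prop :=
  exists n0 : nat,
    ((forall n, (n0 <= n)%N -> d n = 0%N) /\
      z = \sum_(n < n0) (d n)%:Z * N%:Z ^+ n) \/
    ((forall n, (n0 <= n)%N -> d n = N.-1) /\
      z = (\sum_(n < n0) (d n)%:Z * N%:Z ^+ n) - N%:Z ^+ n0).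

Definition Lambda_of (N q : nat) (L : labeling N q) : set int :=
  [set z | exists f, digits_value N (path_label L [::] f) z].

Definition int_embed {R : realType} (A : set int) : set R :=
  [set z%:~R | z in A].

(* Main.v *)
(* Iterating the self-similarity of mu gives, with mu^ the Fourier transform and
   m_D(x) = P_D(e^{2 pi i x}) / |D|, the factorization
   mu^(x) = m_D(x/N) ... m_D(x/N^n) mu^(x/N^n), where mu^(x/N^n) -> 1, so
   mu^(x) = 0 iff m_D(x/N^k) = 0 for some k >= 1. As P_D is the product of the
   Phi_{p^t}, t in T, and T is contained in [1, alpha], this happens iff x is an
   integer whose p-adic valuation lies in S = {alpha k - t : k >= 1, t in T}.
   Orthogonality of frequencies, and likewise the Hadamard condition on the labels
   at a vertex, thus says that differences of distinct elements have valuation in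
   S. A set of base-N digits with this property has at most p^|T| = |D| elements,
   and extends as long as it has fewer. Reading integers in base N from the lowest
   digit, maximality of a set of frequencies means that every prefix that occurs
   has exactly |D| continuations and that every integer all of whose prefixes
   occur belongs to the set. *)

Require Import Defs.
From mathcomp Require Import all_boot all_order all_algebra all_field.
From mathcomp Require Import finmap.
From mathcomp Require Import spectral complex.
From mathcomp Require Import all_classical all_reals all_analysis.
From mathcomp Require Import measurable_realfun.
From mathcomp Require Import zify ring lra.

Set Implicit Arguments.
Unset Strict Implicit.
Unset Printing Implicit Defensive.

Import Order.TTheory GRing.Theory Num.Theory.
Import numFieldNormedType.Exports.

Local Open Scope classical_set_scope.
Local Open Scope ring_scope.

(** * Integers with prescribed valuations *)

(** The [p]-adic valuation of [z] lies in [S]. In terms of exact divisibility, [0] never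
    qualifies. *)
Definition val_in (p : nat) (S : pred nat) (z : int) : Prop :=
  exists j, [/\ S j, (p%:Z ^+ j %| z)%Z & ~~ (p%:Z ^+ j.+1 %| z)%Z].

Lemma val_in_neq0 p S z : val_in p S z -> z != 0.
Proof. by case=> j [_ _]; apply: contraNneq => ->; rewrite dvdz0. Qed.

Lemma val_inN p S z : val_in p S (- z) <-> val_in p S z.
Proof.
by split=> -[j [Sj d nd]]; exists j; move: d nd; rewrite !dvdzE abszN.
Qed.

(** As [p ^ m] does not divide [x], the valuation of [x] is below [m] and survives the addition of a
    multiple of [p ^ m]. *)
Lemma val_in_congr p S m x y :
  (p%:Z ^+ m %| x - y)%Z -> ~~ (p%:Z ^+ m %| x)%Z -> val_in p S x -> val_in p S y.
Proof.
move=> xy nx [j [Sj dx ndx]].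
have ltjm : (j < m)%N.
  rewrite ltnNge; apply: contra nx => lemj.
  by rewrite (dvdz_trans _ dx)// dvdz_exp2l.
have {}xy : (p%:Z ^+ j.+1 %| x - y)%Z.
  by rewrite (dvdz_trans _ xy)// dvdz_exp2l.
exists j; split=> //.
  rewrite -(subKr x y) rpredB//.
  by rewrite (dvdz_trans _ xy)// dvdz_exp2l.
by apply: contra ndx => dy; rewrite -(subrK y x) rpredD.
Qed.

Lemma val_in_mul p S z : (0 < p)%N ->
  val_in p S (p%:Z * z) <-> val_in p (S \o succn) z.
Proof.
move=> p0; have p0' : p%:Z != 0 by rewrite eqz_nat -lt0n.
split=> [[[|j] [Sj d nd]]|[j [Sj d nd]]].
- by move: nd; rewrite expr1 dvdz_mulr.
- by exists j; split=> //; rewrite -(dvdz_mul2l p0') -exprS.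
- by exists j.+1; split=> //; rewrite exprS dvdz_mul2l.
Qed.

Lemma val_in_mulX p S n z : (0 < p)%N ->
  val_in p S (p%:Z ^+ n * z) <-> val_in p (fun j => S (n + j)%N) z.
Proof.
move=> p0; elim: n S => [|n IHn] S; first by rewrite mul1r.
by rewrite exprS -mulrA val_in_mul// IHn.
Qed.

(** * Finite sets whose differences have valuations in [S] *)

Definition val_spaced (p : nat) (S : pred nat) (B : seq nat) : Prop :=
  forall x y, x \in B -> y \in B -> x != y -> val_in p S (x%:Z - y%:Z).

(** One step of recursion on base-[p] digits: fix the lowest digit [r] and strip it. This shifts [S]
    by one. *)
Definition slice (p r : nat) (B : seq nat) : seq nat :=
  [seq (b %/ p)%N | b <- B & (b %% p == r)%N].

Lemma mem_slice p r B x : (r < p)%N -> (x \in slice p r B) = ((r + p * x)%N \in B).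
Proof.
move=> ltrp; apply/mapP/idP => [[b]|xB].
  rewrite mem_filter => /andP[/eqP <- bB] ->.
  by rewrite addnC mulnC -divn_eq.
exists (r + p * x)%N.
  by rewrite mem_filter xB andbT addnC mulnC modnMDl modn_small.
by rewrite addnC mulnC divnMDl ?divn_small ?addn0// (leq_ltn_trans _ ltrp).
Qed.

Lemma slice_uniq p r B : (r < p)%N -> uniq B -> uniq (slice p r B).
Proof.
move=> ltrp uB; rewrite map_inj_in_uniq ?filter_uniq// => x y.
rewrite !mem_filter => /andP[/eqP xr _] /andP[/eqP yr _] exy.
by rewrite (divn_eq x p) (divn_eq y p) xr yr exy.
Qed.

Lemma slice_spaced p S r B : (r < p)%N ->
  val_spaced p S B -> val_spaced p (S \o succn) (slice p r B).
Proof.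
move=> ltrp sB x y; rewrite !mem_slice// => xB yB xy.
apply/val_in_mul; first exact: leq_ltn_trans ltrp.
rewrite (_ : _ * _ = (r + p * x)%:Z - (r + p * y)%:Z); last by lia.
apply: sB => //; apply: contraNneq xy; nia.
Qed.

Lemma slice_ltn p r m B : (r < p)%N -> all (ltn^~ (p ^ m.+1)%N) B ->
  all (ltn^~ (p ^ m)%N) (slice p r B).
Proof.
move=> ltrp /allP aB; apply/allP => x; rewrite mem_slice// => /aB /=.
rewrite expnS => h; rewrite -(ltn_pmul2l (leq_ltn_trans (leq0n r) ltrp)).
exact: leq_ltn_trans (leq_addl _ _) h.
Qed.

Lemma sum_size_slice p B : (0 < p)%N -> (\sum_(r < p) size (slice p r B))%N = size B.
Proof.
move=> p0; elim: B => [|b B IHB]; first by rewrite big1.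
rewrite /= -{}IHB -add1n.
transitivity (\sum_(r < p) ((b %% p == r) + size (slice p r B)))%N.
  by apply: eq_bigr => r _; rewrite /slice /=; case: ifP.
rewrite big_split /=; congr addn.
rewrite (bigD1 (Ordinal (ltn_pmod b p0)))//= eqxx big1 ?addn0// => i.
by rewrite -val_eqE /= eq_sym => /negbTE ->.
Qed.

Lemma count_iota_succ (S : pred nat) m :
  count S (iota 0 m.+1) = (S 0%N + count (S \o succn) (iota 0 m))%N.
Proof. by rewrite /= -[1%N]/(1 + 0)%N iotaDl count_map. Qed.

(** All valuations in [S] are then at least 1, so [p] divides every difference and [B] fills a
    single slice. *)
Lemma not_spaced_dvd p (S : pred nat) B x y : ~~ S 0%N ->
  val_spaced p S B -> x \in B -> y \in B -> (x %% p = y %% p)%N.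
Proof.
move=> nS0 sB xB yB; have [->//|xy] := eqVneq x y.
have [[|j] [Sj d _]] := sB _ _ xB yB xy; first by rewrite Sj in nS0.
have {d} : (p%:Z %| x%:Z - y%:Z)%Z.
  by rewrite (dvdz_trans _ d)// exprS dvdz_mulr.
by rewrite -eqz_mod_dvd => /eqP; rewrite !modz_nat => -[].
Qed.

Lemma spaced_dvd_slice p (S : pred nat) B x : ~~ S 0%N ->
  val_spaced p S B -> x \in B -> size (slice p (x %% p) B) = size B.
Proof.
move=> nS0 sB xB; rewrite size_map size_filter; apply/eqP; rewrite -all_count.
by apply/allP => y yB /=; rewrite (not_spaced_dvd nS0 sB yB xB).
Qed.

(** Induction on the number of base-[p] digits. Each slice obeys the bound for the shifted [S]. If 0
    is in [S], there are [p] slices to add up, whence a factor [p]; otherwise one slice contains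
    everything. *)
Lemma spaced_size p S m B : (0 < p)%N -> uniq B -> all (ltn^~ (p ^ m)%N) B ->
  val_spaced p S B -> (size B <= p ^ count S (iota 0 m))%N.
Proof.
move=> p0; elim: m S B => [|m IHm] S B uB aB sB.
  apply: (@uniq_leq_size _ _ [:: 0%N]) => // x /(allP aB).
  by rewrite expn0 /= ltnS leqn0 inE.
rewrite count_iota_succ.
have IH r : (r < p)%N ->
    (size (slice p r B) <= p ^ count (S \o succn) (iota 0 m))%N.
  move=> ltrp; apply: IHm; [exact: slice_uniq|exact: slice_ltn|].
  exact: slice_spaced.
case S0: (S 0%N) => /=; last first.
  case E: B => [|x B'] //; rewrite -E.
  have xB : x \in B by rewrite E mem_head.
  by rewrite -(spaced_dvd_slice (negbT S0) sB xB) IH// ltn_pmod.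
rewrite -(sum_size_slice B p0) expnS -[X in (_ <= X * _)%N]card_ord -sum_nat_const.
by apply: leq_sum => r _; apply: IH.
Qed.

(** The same recursion on digits: a slice below its capacity is extended by induction, and the new
    element gets back the lowest digit [r] of that slice. *)
Lemma spaced_extend p S m B : (0 < p)%N -> uniq B -> all (ltn^~ (p ^ m)%N) B ->
  val_spaced p S B -> (size B < p ^ count S (iota 0 m))%N ->
  exists2 d, (d < p ^ m)%N & forall b, b \in B -> val_in p S (d%:Z - b%:Z).
Proof.
move=> p0; elim: m S B => [|m IHm] S B uB aB sB.
  by rewrite expn0 ltnS leqn0 size_eq0 => /eqP ->; exists 0%N.
have [->|/hasP[x0 x0B _]] : B = [::] \/ has predT B.
- by case: B {uB aB sB} => [|x B]; [left|right].
- by move=> _; exists 0%N => //; rewrite expn_gt0 p0.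
rewrite count_iota_succ.
have IH r : (r < p)%N ->
    (size (slice p r B) < p ^ count (S \o succn) (iota 0 m))%N ->
    exists2 d, (d < p ^ m.+1)%N & (d %% p = r)%N /\
    forall b, b \in B -> (b %% p = r)%N -> val_in p S (d%:Z - b%:Z).
  move=> ltrp ltB; have [||||d ltd vd] := IHm (S \o succn) (slice p r B) => //.
  - exact: slice_uniq.
  - exact: slice_ltn.
  - exact: slice_spaced.
  exists (r + p * d)%N.
    rewrite expnS (@leq_trans (p + p * d)%N) ?ltn_add2r//.
    by rewrite -mulnS leq_mul2l ltd orbT.
  split; first by rewrite addnC mulnC modnMDl modn_small.
  move=> b bB br; have := vd (b %/ p)%N.
  rewrite mem_slice// {1}mulnC addnC -{1}br -divn_eq => /(_ bB) /val_in_mul.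
  move=> /(_ p0); congr (val_in _ _ _).
  by rewrite [in RHS](divn_eq b p) br; lia.
case S0: (S 0%N) => /=; last first.
  rewrite -(spaced_dvd_slice (negbT S0) sB x0B) => ltB.
  have [|d ltd [_ vd]] := IH _ _ ltB; first by rewrite ltn_pmod.
  exists d => // b bB; apply: vd => //; exact: not_spaced_dvd (negbT S0) sB _ _.
rewrite add1n => ltB.
(* Pigeonhole: [B] is smaller than [p] full slices, so some slice is not full. *)
have [r ltr] : exists r : 'I_p,
    (size (slice p r B) < p ^ count (S \o succn) (iota 0 m))%N.
  apply/existsP; apply: contraTT ltB; rewrite negb_exists => /forallP geB.
  rewrite -leqNgt expnS -(sum_size_slice B p0) -[X in (X * _ <= _)%N]card_ord -sum_nat_const.
  by apply: leq_sum => r _; rewrite leqNgt geB.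
have [d ltd [dr vd]] := IH _ (ltn_ord r) ltr.
(* Elements of other residue classes differ from [d] by a non-multiple of [p], and the valuation 0
   lies in [S]. *)
exists d => // b bB; have [/(vd _ bB)//|nbr] := eqVneq (b %% p)%N r.
exists 0%N; split; [exact: S0|exact: dvd1z|].
by rewrite expr1 -eqz_mod_dvd !modz_nat dr eqz_nat eq_sym.
Qed.

(** * Base-N digits *)

(** The [N]-adic expansion: the quotient is rounded down, so the digits of a negative integer end in
    [N - 1], as in [digits_value]. *)
Definition digit (N : nat) (z : int) (n : nat) : nat :=
  absz ((z %/ N%:Z ^+ n)%Z %% N%:Z)%Z.

Section Digits.
Variable N : nat.
Hypothesis N_gt1 : (1 < N)%N.

Let N0 n : N%:Z ^+ n != 0.
Proof. by rewrite expf_neq0 // eqz_nat -lt0n ltnW. Qed.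

Let N0' : N%:Z != 0.
Proof. by rewrite eqz_nat -lt0n ltnW. Qed.

Lemma digitE z n : (digit N z n)%:Z = ((z %/ N%:Z ^+ n)%Z %% N%:Z)%Z.
Proof. by rewrite /digit gez0_abs// modz_ge0. Qed.

Lemma ltn_digit z n : (digit N z n < N)%N.
Proof. by rewrite -ltz_nat digitE ltz_pmod// ltz_nat ltnW. Qed.

Lemma digit_expansion z n :
  z = \sum_(i < n) (digit N z i)%:Z * N%:Z ^+ i + (z %/ N%:Z ^+ n)%Z * N%:Z ^+ n.
Proof.
elim: n => [|n IHn]; first by rewrite big_ord0 add0r expr0 divz1 mulr1.
rewrite big_ord_recr /= -addrA {1}IHn; congr (_ + _).
rewrite digitE exprSr divzMA_ge0 ?exprn_ge0// mulrA mulrAC -mulrDl addrC.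
by rewrite -divz_eq.
Qed.

Lemma digit_dvdP x y n :
  (N%:Z ^+ n %| x - y)%Z <-> forall i, (i < n)%N -> digit N x i = digit N y i.
Proof.
split=> [dxy i ltin|exy].
  have {dxy} /dvdzP[k exy] : (N%:Z ^+ i.+1 %| x - y)%Z.
    by rewrite (dvdz_trans _ dxy)// dvdz_exp2l.
  apply/eqP; rewrite -eqz_nat !digitE -[x](subrK y) exy exprS mulrA divzMDl//.
  by rewrite modzMDl.
rewrite (digit_expansion x n) (digit_expansion y n).
rewrite (eq_bigr (fun i : 'I_n => (digit N y i)%:Z * N%:Z ^+ i)); last first.
  by move=> i _; rewrite exy.
by rewrite opprD addrACA subrr add0r -mulrBl dvdz_mull.
Qed.

Lemma digit_sum_bound (d : nat -> nat) n : (forall i, (d i < N)%N) ->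
  0 <= \sum_(i < n) (d i)%:Z * N%:Z ^+ i < N%:Z ^+ n.
Proof.
move=> ltd; elim: n => [|n /andP[ge0 ltn]]; first by rewrite big_ord0.
rewrite big_ord_recr /= addr_ge0 ?mulr_ge0 ?exprn_ge0//=.
have := ltd n; set S := \sum_(i < n) _ in ge0 ltn *; rewrite exprS.
move: (N%:Z ^+ n) ltn => M ltn ltdn; nia.
Qed.

(** The free multiple of [N ^ n] absorbs all higher digits: the induction moves the top digit of the
    sum into [k]. *)
Lemma digit_unique (d : nat -> nat) n k z : (forall i, (d i < N)%N) ->
  z = \sum_(i < n) (d i)%:Z * N%:Z ^+ i + k * N%:Z ^+ n ->
  forall i, (i < n)%N -> digit N z i = d i.
Proof.
move=> ltd; elim: n k => [//|n IHn] k ez i.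
have {}ez : z = \sum_(i < n) (d i)%:Z * N%:Z ^+ i + (k * N%:Z + (d n)%:Z) * N%:Z ^+ n.
  by rewrite ez big_ord_recr /= exprS; ring.
rewrite ltnS leq_eqVlt => /orP[/eqP ->|]; last exact: IHn ez i.
apply/eqP; rewrite -eqz_nat digitE ez addrC divzMDl// divz_small; last first.
  by rewrite gez0_abs ?exprn_ge0// digit_sum_bound.
by rewrite addr0 modzMDl modz_nat modn_small.
Qed.

(** Since [n < N ^ n], the crude bound by [n] suffices; it makes [|z|] an explicit index from which
    the digits are constant. *)
Lemma divz_exp_ge0 (z : int) n : 0 <= z -> (`|z| <= n)%N -> (z %/ N%:Z ^+ n)%Z = 0.
Proof.
move=> z0 lezn; apply: divz_small; rewrite z0 -(gez0_abs z0) abszX ltz_nat.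
exact: leq_ltn_trans lezn (ltn_expl _ N_gt1).
Qed.

Lemma divz_exp_lt0 (z : int) n : z < 0 -> (`|z| <= n)%N -> (z %/ N%:Z ^+ n)%Z = -1.
Proof.
move=> z0 lezn; rewrite (_ : z = -1 * N%:Z ^+ n + (z + N%:Z ^+ n)); last by ring.
rewrite divzMDl// divz_small ?addr0//.
have : `|z|%:Z < N%:Z ^+ n.
  by rewrite -rmorphXn ltz_nat (leq_ltn_trans lezn)// ltn_expl.
by move: (N%:Z ^+ n) => M; lia.
Qed.

Lemma digit_ge0 (z : int) n : 0 <= z -> (`|z| <= n)%N -> digit N z n = 0%N.
Proof. by move=> z0 lezn; rewrite /digit divz_exp_ge0 ?mod0z. Qed.

Lemma digit_lt0 (z : int) n : z < 0 -> (`|z| <= n)%N -> digit N z n = N.-1.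
Proof.
move=> z0 lezn; apply/eqP; rewrite -eqz_nat digitE divz_exp_lt0//.
rewrite -(modzMDl 1) modz_small; lia.
Qed.

(** [N ^ |x - y|] exceeds [|x - y|] and cannot divide it, so some digit differs; the least such
    index is taken. *)
Lemma digit_neq x y : x != y -> exists n,
  (forall i, (i < n)%N -> digit N x i = digit N y i) /\ digit N x n != digit N y n.
Proof.
move=> xy; pose P n := digit N x n != digit N y n.
have exP : exists n, P n.
  have [n ndvd] : exists n, ~~ (N%:Z ^+ n %| x - y)%Z.
    exists `|x - y|%N; rewrite dvdzE abszX; apply/negP => /dvdn_leq.
    by rewrite absz_gt0 subr_eq0 xy => /(_ isT); rewrite leqNgt ltn_expl.
  case: (pickP (fun i : 'I_n => P i)) => [i Pi|nP]; first by exists i.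
  case/negP: ndvd; apply/digit_dvdP => i ltin.
  by have /negbFE/eqP := nP (Ordinal ltin).
case: (ex_minnP exP) => n Pn minn; exists n; split=> // i ltin.
by apply/eqP; apply: contraTT ltin => /minn; rewrite leqNgt.
Qed.

End Digits.

(** With [n] common digits, [x - y] is [N ^ n] times the difference of the quotients. The factor
    [p ^ (alpha * n)] is harmless because [S] is [alpha]-periodic, and modulo [N] the quotients are
    the digits at [n], whose difference [N] does not divide. *)
Lemma val_in_digit p alpha (S : pred nat) x y n : (1 < p)%N -> (0 < alpha)%N ->
  (forall j, S (alpha + j)%N = S j) ->
  (forall i, (i < n)%N -> digit (p ^ alpha) x i = digit (p ^ alpha) y i) ->
  digit (p ^ alpha) x n != digit (p ^ alpha) y n ->
  val_in p S (x - y) <->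
  val_in p S ((digit (p ^ alpha) x n)%:Z - (digit (p ^ alpha) y n)%:Z).
Proof.
move=> p1 a0 perS; set N := (p ^ alpha)%N => exy nxy.
have N1 : (1 < N)%N by rewrite -(exp1n alpha) ltn_exp2r.
have NE : N%:Z = p%:Z ^+ alpha by rewrite /N -rmorphXn.
have perSn j : S (alpha * n + j)%N = S j.
  by elim: n {exy nxy} => [|n IHn]; rewrite ?muln0// mulnS -addnA perS.
pose x' := (x %/ N%:Z ^+ n)%Z; pose y' := (y %/ N%:Z ^+ n)%Z.
have -> : x - y = p%:Z ^+ (alpha * n) * (x' - y').
  rewrite (digit_expansion N1 x n) (digit_expansion N1 y n).
  rewrite (eq_bigr (fun i : 'I_n => (digit N y i)%:Z * N%:Z ^+ i)); last first.
    by move=> i _; rewrite exy.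
  by rewrite exprM -NE -/x' -/y'; ring.
rewrite val_in_mulX; last exact: ltnW.
have -> : val_in p (fun j => S (alpha * n + j)%N) (x' - y') <-> val_in p S (x' - y').
  by split=> -[j [Sj d nd]]; exists j; split=> //; rewrite perSn in Sj *.
have congr_xy : (p%:Z ^+ alpha %| x' - y' - ((digit N x n)%:Z - (digit N y n)%:Z))%Z.
  rewrite !digitE// -/x' -/y' -NE {1}(divz_eq x' N) {1}(divz_eq y' N).
  by apply/dvdzP; exists ((x' %/ N)%Z - (y' %/ N)%Z); ring.
have ndvd : ~~ (p%:Z ^+ alpha %| (digit N x n)%:Z - (digit N y n)%:Z)%Z.
  rewrite -NE -eqz_mod_dvd !modz_nat !modn_small ?ltn_digit//.
split; apply: val_in_congr; first exact: congr_xy.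
- by apply: contra ndvd => d; rewrite -(subKr (x' - y') (_ - _)) rpredB.
- by rewrite -opprB dvdzE abszN -dvdzE; exact: congr_xy.
- exact: ndvd.
Qed.

(** * Labelings and digits *)

Lemma infinite_path q (P : seq 'I_q -> Prop) v : P v ->
  (forall w, P w -> exists i, P (rcons w i)) ->
  exists f, forall n, P (v ++ mkseq f n).
Proof.
(* [i0] is a default child for the words outside [P], where [step] gives nothing. *)
move=> Pv step; have [i0 _] := step _ Pv.
have /choice[g Pg] : forall w, exists i, P w -> P (rcons w i).
  move=> w; have [/step[i Pi]|nP] := pselect (P w); first by exists i.
  by exists i0.
pose w n := iter n (fun w => rcons w (g w)) v.
exists (fun n => g (w n)) => n.
suff -> : v ++ mkseq (fun n => g (w n)) n = w n by elim: n => //= n /Pg.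
elim: n => [|n IHn]; first by rewrite cats0.
by rewrite mkseqS -rcons_cat IHn.
Qed.

Lemma prefix_rconsr (T : eqType) (s t : seq T) y :
  prefix s (rcons t y) = (s == rcons t y) || prefix s t.
Proof.
apply/idP/orP => [/prefixP[r]|[/eqP ->|st]]; last 2 first.
- exact: prefix_refl.
- exact: prefix_trans st (prefix_rcons _ _).
elim/last_ind: r => [|r z _]; first by rewrite cats0 => ->; left.
by rewrite -rcons_cat => /rcons_inj[-> _]; right; exact: prefix_prefix.
Qed.

Section Matches.
Variables (N q : nat) (L : labeling N q).
Hypothesis N_gt1 : (1 < N)%N.

(* [z] and the path from the root to [w] agree on the first [size w] digits. *)
Definition matches (z : int) (w : seq 'I_q) : Prop :=
  forall u i, prefix (rcons u i) w -> L u i = digit N z (size u) :> nat.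

Lemma matches_nil z : matches z [::].
Proof. by move=> [|? ?]. Qed.

Lemma matches_rcons z w i :
  matches z (rcons w i) <-> matches z w /\ L w i = digit N z (size w) :> nat.
Proof.
split=> [m|[m Lwi] u j].
  split=> [u j pu|]; last exact/m/prefix_refl.
  by apply: m; rewrite prefix_rconsr pu orbT.
by rewrite prefix_rconsr eqseq_rcons => /orP[/andP[/eqP -> /eqP ->]|/m].
Qed.

Lemma path_matches z v f : matches z v ->
  (forall n, matches z (v ++ mkseq f n)) <->
  (forall n, path_label L v f n = digit N z (size v + n)).
Proof.
move=> mv; split=> [m n|lab n].
  have := m n.+1; rewrite mkseqS -rcons_cat => /matches_rcons[_].
  by rewrite size_cat size_mkseq.
elim: n => [|n IHn]; first by rewrite cats0.
rewrite mkseqS -rcons_cat; apply/matches_rcons; split=> //.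
by rewrite size_cat size_mkseq -lab.
Qed.

Lemma matches_congr x y w : matches x w -> matches y w ->
  forall i, (i < size w)%N -> digit N x i = digit N y i.
Proof.
elim/last_ind: w => [//|w j IHw] /matches_rcons[mx ex] /matches_rcons[my ey] i.
rewrite size_rcons ltnS leq_eqVlt => /orP[/eqP ->|]; last exact: IHw.
by rewrite -ex -ey.
Qed.

Lemma congr_matches x y w : (forall i, (i < size w)%N -> digit N x i = digit N y i) ->
  matches x w -> matches y w.
Proof.
move=> exy m u i pu; rewrite m// exy//.
by have := size_prefix pu; rewrite size_rcons.
Qed.

(** Siblings carry distinct labels, so each digit of [x] determines the next child. *)
Lemma matches_inj x w w' : (forall v, injective (L v)) ->
  size w = size w' -> matches x w -> matches x w' -> w = w'.
Proof.
move=> injL; elim/last_ind: w w' => [|w j IHw] w'; elim/last_ind: w' => [|w' j' _] //.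
- by rewrite size_rcons.
- by rewrite size_rcons.
rewrite !size_rcons => -[sw] /matches_rcons[mw ej] /matches_rcons[mw' ej'].
have ww' := IHw _ sw mw mw'; rewrite -ww' in ej' *.
by congr rcons; apply: (injL w); apply: val_inj; rewrite /= ej ej'.
Qed.

Lemma digits_value_digit z : digits_value N (digit N z) z.
Proof.
exists `|z|%N; have [z0|z0] := lerP 0 z; [left|right]; split=> [n|].
- exact: digit_ge0.
- by rewrite {1}(digit_expansion N_gt1 z `|z|) divz_exp_ge0// mul0r addr0.
- exact: digit_lt0.
- by rewrite {1}(digit_expansion N_gt1 z `|z|) divz_exp_lt0// mulN1r.
Qed.

Lemma digit_digits_value d z : (forall i, (d i < N)%N) -> digits_value N d z ->
  forall i, digit N z i = d i.
Proof.
move=> ltd [n0 dz] i.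
(* The expansion is padded until it covers position [i]. A tail of zeros leaves [k = 0]; a tail of
   [N - 1] leaves [k = -1], as [(N - 1) * N ^ m - N ^ m.+1 = - N ^ m]. *)
suff [k ez] : exists k : int,
    z = \sum_(j < n0 + i.+1) (d j)%:Z * N%:Z ^+ j + k * N%:Z ^+ (n0 + i.+1).
  by apply: (digit_unique N_gt1 ltd ez); rewrite addnS ltnS leq_addl.
case: dz => -[dt ->]; [exists 0|exists (-1)]; elim: i.+1 => [|m IHm].
- by rewrite addn0 mul0r addr0.
- by rewrite addnS big_ord_recr /= dt ?leq_addr// IHm; ring.
- by rewrite addn0 mulN1r.
rewrite addnS big_ord_recr /= dt ?leq_addr// IHm exprS predn_int; last exact: ltnW.
by ring.
Qed.

Lemma eventually_digits_value d :
  eventually_eq d 0 \/ eventually_eq d N.-1 -> exists z, digits_value N d z.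
Proof. by case=> -[n0 dn0]; eexists; exists n0; [left|right]. Qed.

(** The digits of an integer are always eventually [0] or [N - 1], so following a path with all
    digits already makes the path eventually constant. *)
Lemma Lambda_ofP z : Lambda_of L z <-> exists f, forall n, matches z (mkseq f n).
Proof.
split=> -[f].
  move=> /digit_digits_value zf; exists f.
  by apply/(path_matches f (matches_nil z)) => n; rewrite -zf// => i; exact: ltn_ord.
move=> /(path_matches f (matches_nil z)) zf; exists f.
rewrite (_ : path_label _ _ _ = digit N z); last by apply/funext => n; rewrite zf.
exact: digits_value_digit.
Qed.

(** This is how condition (2) of a spectral labeling is used: every vertex lies on the path of some
    element. *)
Lemma Lambda_of_extend w :
  (exists f, eventually_eq (path_label L w f) 0 \/
             eventually_eq (path_label L w f) N.-1) ->
  exists2 z, Lambda_of L z & matches z w.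
Proof.
(* [g] runs through [w] and then follows [f]; [f 0] is only the default value of [nth]. *)
move=> [f ev]; pose g n := if (n < size w)%N then nth (f 0%N) w n else f (n - size w)%N.
have gw k : mkseq g (size w + k) = w ++ mkseq f k.
  rewrite /mkseq iotaD map_cat add0n; congr cat.
    rewrite -[RHS](mkseq_nth (f 0%N)); apply/eq_in_map => i.
    by rewrite mem_iota /g => /= ->.
  rewrite -[size w in LHS]addn0 iotaDl -map_comp; apply: eq_map => i /=.
  by rewrite /g ltnNge leq_addr addKn.
have gE k : path_label L [::] g (size w + k) = path_label L w f k.
  by rewrite /path_label /= gw /g ltnNge leq_addr addKn.
have [z dz] : exists z, digits_value N (path_label L [::] g) z.
  apply: eventually_digits_value.
  by case: ev => -[n0 fn0]; [left|right]; exists (size w + n0)%N => n le_n;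
    rewrite -(subnKC (leq_trans (leq_addr _ _) le_n)) gE fn0// leq_subRL//
      (leq_trans (leq_addr _ _) le_n).
exists z; first by exists g.
have /(path_matches g (matches_nil z)) m n : path_label L [::] g n = digit N z n.
  by rewrite (digit_digits_value _ dz)// => i; exact: ltn_ord.
by have := m (size w); rewrite /= -[size w]addn0 gw cats0.
Qed.

End Matches.

(** * Labelings and maximal sets of integers with differences of valuation in [S] *)

Section Combinatorics.
Variables (p alpha q : nat) (S : pred nat).
Hypotheses (p_gt1 : (1 < p)%N) (alpha_gt0 : (0 < alpha)%N).
Hypothesis (perS : forall j, S (alpha + j)%N = S j).
Let N := (p ^ alpha)%N.
Hypothesis q_def : q = (p ^ count S (iota 0 alpha))%N.

Let N_gt1 : (1 < N)%N.
Proof. by rewrite -(exp1n alpha) ltn_exp2r. Qed.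

Let p_gt0 : (0 < p)%N. Proof. exact: ltnW. Qed.

Let dvd_digit n x y :
  (p%:Z ^+ (alpha * n) %| x - y)%Z <-> forall i, (i < n)%N -> digit N x i = digit N y i.
Proof.
rewrite -(digit_dvdP N_gt1) exprM.
by rewrite (_ : p%:Z ^+ alpha = N%:Z)// /N -rmorphXn.
Qed.

(** The form that the Hadamard condition at all vertices takes when expressed by valuations. *)
Definition spaced_labeling (L : labeling N q) : Prop :=
  forall v, injective (L v) /\
    forall i j, L v i != L v j -> val_in p S ((L v i)%:Z - (L v j)%:Z).

(** Up to the first differing digit the two paths coincide; the differing digits are then labels of
    two children of one vertex, and [val_in_digit] transfers their spacing to [x - y]. *)
Lemma Lambda_of_spaced (L : labeling N q) x y : spaced_labeling L ->
  Lambda_of L x -> Lambda_of L y -> x != y -> val_in p S (x - y).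
Proof.
move=> sL /(Lambda_ofP L N_gt1)[f mf] /(Lambda_ofP L N_gt1)[g mg].
move=> /(digit_neq N_gt1)[n [exy nxy]].
apply/(val_in_digit p_gt1 alpha_gt0 perS exy nxy).
have fg : mkseq f n = mkseq g n.
  apply: (matches_inj (fun v => (sL v).1) _ (mf n)); rewrite ?size_mkseq//.
  by apply: congr_matches (mg n) => i; rewrite size_mkseq => /exy.
have := mf n.+1; rewrite mkseqS => /matches_rcons[_]; rewrite size_mkseq => ex.
have := mg n.+1; rewrite mkseqS -fg => /matches_rcons[_]; rewrite size_mkseq => ey.
move: nxy; rewrite -/N -ex -ey; exact: (sL _).2.
Qed.

(** Follow the digits of [z] down the tree. If no child of [w] carried the next one, that digit and
    the [q] labels at [w] would be [q + 1] spaced numbers below [N], against [spaced_size]. The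
    spacing comes from comparing [z] with an element passing through each child. *)
Lemma Lambda_of_maximal (L : labeling N q) z : spaced_labeling L ->
  (forall v, exists f, eventually_eq (path_label L v f) 0 \/
                       eventually_eq (path_label L v f) N.-1) ->
  (forall x, Lambda_of L x -> x != z -> val_in p S (z - x)) -> Lambda_of L z.
Proof.
move=> sL ev zmax; apply/(Lambda_ofP L N_gt1).
apply: (infinite_path (v := [::]) (matches_nil L z)) => w mw.
apply: contrapT => nw.
pose B := digit N z (size w) :: [seq nat_of_ord (L w i) | i : 'I_q].
have neq i : digit N z (size w) != L w i.
  apply/negP => /eqP ezi; apply: nw; exists i; exact/matches_rcons.
have vneq i : val_in p S ((digit N z (size w))%:Z - (L w i)%:Z).
  have [x Lx /matches_rcons[mx ex]] := Lambda_of_extend N_gt1 (ev (rcons w i)).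
  have := neq i; rewrite ex => nzx.
  apply/(val_in_digit p_gt1 alpha_gt0 perS _ nzx).
    exact: matches_congr mw mx.
  by apply: zmax => //; apply: contraNneq nzx => ->.
have : (size B <= q)%N.
  rewrite q_def; apply: spaced_size => //.
  - rewrite /= map_inj_uniq ?enum_uniq ?andbT; last first.
      by move=> i j /val_inj; exact: (sL w).1.
    by apply/negP => /mapP[i _ /eqP]; rewrite (negbTE (neq i)).
  - rewrite /= ltn_digit//=; apply/allP => _ /mapP[i _ ->]; exact: ltn_ord.
  - move=> x y; rewrite !inE.
    move=> /orP[/eqP ->|/mapP[i _ ->]] /orP[/eqP ->|/mapP[j _ ->]] //.
    + by rewrite eqxx.
    + by move=> _; rewrite -opprB; apply/val_inN.
    + exact: (sL w).2.
by rewrite /= size_map size_enum_ord ltnn.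
Qed.

Variable Lambda : set int.
Hypothesis Lambda0 : Lambda 0.
Hypothesis Lambda_spaced : forall x y, Lambda x -> Lambda y -> x != y -> val_in p S (x - y).
Hypothesis Lambda_max : forall z,
  (forall x, Lambda x -> x != z -> val_in p S (z - x)) -> Lambda z.

(** Given [x], some [y] in [Lambda] agrees with [z] past the first digit where [x] and [z] differ.
    Then [z - x] and [y - x] have the same valuation, and maximality applies. *)
Lemma Lambda_closed z : (forall n, exists2 x, Lambda x &
    forall i, (i < n)%N -> digit N x i = digit N z i) -> Lambda z.
Proof.
move=> approx; apply: Lambda_max => x Lx xz.
have [n [exz nxz]] := digit_neq N_gt1 xz.
have [y Ly eyz] := approx n.+1.
apply: (@val_in_congr p S (alpha * n.+1) (y - x)).
- by rewrite opprB addrA subrK; apply/dvd_digit.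
- apply/negP => /dvd_digit eyx; case/eqP: nxz; rewrite -eyx ?eyz//.
- apply: Lambda_spaced => //; apply: contraNneq nxz => <-; by rewrite eyz.
Qed.

(** The digits that continue the first [n] digits of [x0] within [Lambda] form a spaced set [B]. If
    it had fewer than [q] elements, [spaced_extend] would give a further digit, and maximality would
    force that digit into [B]. *)
Lemma Lambda_branch x0 n : Lambda x0 -> exists e : 'I_q -> int,
  [/\ forall i, Lambda (e i) /\ forall k, (k < n)%N -> digit N (e i) k = digit N x0 k,
      injective (fun i => digit N (e i) n) &
      forall x, Lambda x -> (forall k, (k < n)%N -> digit N x k = digit N x0 k) ->
        exists i, digit N (e i) n = digit N x n].
Proof.
move=> Lx0.
pose P d := exists2 x, Lambda x &
  (forall k, (k < n)%N -> digit N x k = digit N x0 k) /\ digit N x n = d.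
pose B := [seq d <- iota 0 N | `[< P d >]].
have uB : uniq B by rewrite filter_uniq ?iota_uniq.
have ltB : all (ltn^~ N) B.
  by apply/allP => d; rewrite mem_filter mem_iota => /and3P[].
have BP d : d \in B <-> P d.
  rewrite mem_filter mem_iota /=; split=> [/andP[/asboolP]//|Pd].
  rewrite add0n; apply/andP; split; first exact/asboolP.
  by case: Pd => x _ [_ <-]; exact: ltn_digit.
have sB : val_spaced p S B.
  move=> _ _ /BP[x Lx [ex <-]] /BP[y Ly [ey <-]] nxy.
  apply/(val_in_digit p_gt1 alpha_gt0 perS _ nxy).
    by move=> i lti; rewrite ex// ey.
  by apply: Lambda_spaced => //; apply: contraNneq nxy => ->.
have szB : size B = q.
  apply/eqP; rewrite eqn_leq q_def spaced_size//= leqNgt; apply/negP => ltBq.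
  have [d ltd vd] := spaced_extend p_gt0 uB ltB sB ltBq.
  (* [z] is [x0] with its digit at [n] replaced by [d]. *)
  pose z := x0 + (d%:Z - (digit N x0 n)%:Z) * N%:Z ^+ n.
  have ez k : (k < n)%N -> digit N z k = digit N x0 k.
    move: k; apply/(digit_dvdP N_gt1).
    by rewrite /z addrAC subrr add0r dvdz_mull.
  have ezn : digit N z n = d.
    apply/eqP; rewrite -eqz_nat digitE// /z addrC divzMDl; last first.
      by rewrite expf_neq0// eqz_nat -lt0n ltnW.
    rewrite -modzDmr -digitE// subrK modz_nat modn_small//.
  (* If [d] were in [B], it would be spaced from itself, but [0] has no valuation. *)
  suff /BP/vd/val_in_neq0 : P d by rewrite subrr.
  exists z => //; apply: Lambda_max => x Lx xz.
  have [exz|nxz] := pselect (forall k, (k < n)%N -> digit N x k = digit N x0 k).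
    have dx : digit N x n \in B by apply/BP; exists x.
    have vzx : val_in p S ((digit N z n)%:Z - (digit N x n)%:Z) by rewrite ezn; exact: vd.
    apply/(val_in_digit p_gt1 alpha_gt0 perS (n := n)); last exact: vzx.
      by move=> i lti; rewrite ez// exz.
    by have := val_in_neq0 vzx; rewrite subr_eq0 eqz_nat.
  (* An [x] with other first digits is separated from [x0] within those digits, hence from [z],
     which shares them with [x0]. *)
  apply: (@val_in_congr p S (alpha * n) (x0 - x)).
  - by rewrite opprB addrA subrK; apply/dvd_digit => k ltk; rewrite ez.
  - by apply/negP => /dvd_digit ex0; apply: nxz => k ltk; rewrite ex0.
  - by apply: Lambda_spaced => //; apply/eqP => ex0; apply: nxz => k _; rewrite ex0.
have /choice[e eP] : forall i : 'I_q, exists x, Lambda x /\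
    ((forall k, (k < n)%N -> digit N x k = digit N x0 k) /\ digit N x n = nth 0%N B i).
  move=> i; have /BP[x Lx ex] : nth 0%N B i \in B by rewrite mem_nth// szB.
  by exists x.
exists e; split=> [i|i j|x Lx ex].
- by have [? []] := eP i.
- have [_ [_ ->]] := eP i; have [_ [_ ->]] := eP j.
  by move/eqP; rewrite nth_uniq ?szB// => /eqP/val_inj.
- have dx : digit N x n \in B by apply/BP; exists x.
  have lti : (index (digit N x n) B < q)%N by rewrite -szB index_mem.
  exists (Ordinal lti); have [_ [_ ->]] := eP (Ordinal lti).
  by rewrite nth_index.
Qed.

(** Each vertex receives a representative in [Lambda] whose first digits are the labels leading to
    it; [Lambda_branch] supplies the representatives of its children, and a child's label is the new
    digit of its representative. *)
Lemma labeling_of_Lambda : exists L : labeling N q,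
  [/\ spaced_labeling L,
      exists f, forall n, path_label L [::] f n = 0%N,
      forall v, exists f, eventually_eq (path_label L v f) 0 \/
                          eventually_eq (path_label L v f) N.-1 &
      Lambda = Lambda_of L].
Proof.
(* A state is a level with a representative at that level; outside [Lambda] the value of [next] is
   arbitrary. *)
have /choice[next nextP] : forall s : nat * int, exists e : 'I_q -> int, Lambda s.2 ->
  [/\ forall i, Lambda (e i) /\ forall k, (k < s.1)%N -> digit N (e i) k = digit N s.2 k,
      injective (fun i => digit N (e i) s.1) &
      forall x, Lambda x -> (forall k, (k < s.1)%N -> digit N x k = digit N s.2 k) ->
        exists i, digit N (e i) s.1 = digit N x s.1].
  move=> [n x]; have [/(Lambda_branch n)[e eP]|nL] := pselect (Lambda x).
    by exists e.
  by exists (fun=> 0).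
pose step s i := (s.1.+1, next s i).
pose tr := foldl step (0%N, 0).
have tr_rcons v i : tr (rcons v i) = step (tr v) i by rewrite /tr foldl_rcons.
have tr1 v : (tr v).1 = size v.
  by elim/last_ind: v => //= v i IHv; rewrite tr_rcons size_rcons /= IHv.
have Ltr v : Lambda (tr v).2.
  elim/last_ind: v => //= v i IHv; rewrite tr_rcons /=.
  by have [/(_ i)[]] := nextP _ IHv.
pose L : labeling N q := fun v i =>
  Ordinal (ltn_digit N_gt1 (tr (rcons v i)).2 (size v)).
have mtr v : matches L (tr v).2 v.
  elim/last_ind: v => [|v i IHv]; first exact: matches_nil.
  apply/matches_rcons; split=> //; rewrite tr_rcons /=.
  apply: congr_matches IHv => k; rewrite -tr1 => ltk.
  by have [/(_ i)[_ ->]] := nextP _ (Ltr v).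
have mstep x v : Lambda x -> matches L x v -> exists i, matches L x (rcons v i).
  move=> Lx mx; have [_ _ /(_ x Lx)[]] := nextP _ (Ltr v).
    by rewrite tr1; exact: matches_congr mx (mtr v).
  by move=> i ei; exists i; apply/matches_rcons; split; rewrite //= tr_rcons /= -tr1.
have mpath x v : Lambda x -> matches L x v ->
    exists f, forall n, path_label L v f n = digit N x (size v + n).
  move=> Lx mx; have [|f mf] := infinite_path mx; first by move=> w; exact: mstep.
  by exists f; apply/path_matches.
exists L; split.
- move=> v; have [nx1 nx2 nx3] := nextP _ (Ltr v).
  split=> [i j [eij]|i j nij].
    by apply: nx2; move: eij; rewrite !tr_rcons /= tr1.
  apply/(val_in_digit p_gt1 alpha_gt0 perS (x := (tr (rcons v i)).2)
    (y := (tr (rcons v j)).2) (n := size v)) => //.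
    move=> k ltk; rewrite !tr_rcons /=.
    by rewrite (nx1 i).2 ?(nx1 j).2 ?tr1.
  apply: Lambda_spaced => //; apply: contraNneq nij => eij.
  by apply/eqP/val_inj; rewrite /= eij.
- have [f f0] := mpath 0 [::] Lambda0 (matches_nil _ _).
  by exists f => n; rewrite f0 digit_ge0.
(* From [v] on, the path follows the digits of the representative of [v], which are eventually
   constant by its sign. *)
- move=> v; have [f fv] := mpath _ _ (Ltr v) (mtr v); exists f.
  have [z0|z0] := lerP 0 (tr v).2; [left|right]; exists `|(tr v).2|%N => n len.
    by rewrite fv digit_ge0// (leq_trans len)// leq_addl.
  by rewrite fv digit_lt0// (leq_trans len)// leq_addl.
- apply/seteqP; split=> [x Lx|x /(Lambda_ofP L N_gt1)[f mf]].
    have [f fx] := mpath x [::] Lx (matches_nil _ _).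
    by apply/(Lambda_ofP L N_gt1); exists f; apply/(path_matches f (matches_nil L x)).
  (* The representatives of the vertices on the path of [x] agree with ever more digits of [x]. *)
  apply: Lambda_closed => n; exists (tr (mkseq f n)).2 => //.
  by have := matches_congr (mtr (mkseq f n)) (mf n); rewrite size_mkseq.
Qed.

End Combinatorics.

(** * The Fourier transform of the Cantor measure *)

Section CantorMeasure.
Variables (R : realType) (N : nat) (D : {fset nat}).
Variable mu : probability (measurableTypeR R) R.
Hypothesis cantor_mu : is_cantor_measure N D mu.

Lemma measurable_phi d : measurable_fun [set: measurableTypeR R] (phi N d : measurableTypeR R -> _).
Proof.
apply: measurable_funM => //; apply: measurable_funD => //; exact: measurable_cst.
Qed.

Lemma ge0_integral_cantor (f : R -> R) : measurable_fun [set: measurableTypeR R] f ->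
  (forall x, 0 <= f x) ->
  (\int[mu]_x (f x)%:E =
   (#|` D|%:R^-1)%:E * \sum_(d <- D) \int[mu]_x (f (phi N d x))%:E)%E.
Proof.
move=> mf f0.
have mfE : measurable_fun [set: measurableTypeR R] (EFin \o f) by exact/measurable_EFinP.
(* [msum] sums a family of measures indexed by [nat], hence the enumeration of [D] by [nth]. *)
have /choice[m mE] : forall n, exists m : {measure set (measurableTypeR R) -> \bar R},
    (forall A, m A = pushforward mu (phi N (nth 0%N D n)) A) /\
    (\int[m]_x (f x)%:E = \int[mu]_x (f (phi N (nth 0%N D n) x))%:E)%E.
  move=> n; unshelve eexists
      [the {measure set _ -> \bar R} of pushforward mu (phi N (nth 0%N D n))].
    exact: measurable_phi.
  split=> //=; rewrite ge0_integral_pushforward//; first exact: measurable_phi.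
  by move=> x _; rewrite lee_fin.
rewrite (eq_measure_integral (mscale (#|` D|%:R^-1)%:nng (msum m #|` D|))); last first.
  move=> A mA _; apply: etrans (cantor_mu mA) _; rewrite /mscale /=; congr (_ * _)%E.
  by rewrite /msum (big_nth 0%N) big_mkord; apply: eq_bigr => i _; rewrite (mE i).1.
rewrite ge0_integral_mscale//=; last first.
  by move=> x _; rewrite lee_fin.
congr (_ * _)%E.
rewrite ge0_integral_measure_sum//=; last by move=> x _; rewrite lee_fin.
by rewrite (big_nth 0%N) big_mkord; apply: eq_bigr => i _; rewrite (mE i).2.
Qed.

Lemma integrable_bounded (M : R) (f : R -> R) :
  measurable_fun [set: measurableTypeR R] f -> (forall x, `|f x| <= M) ->
  mu.-integrable [set: measurableTypeR R] (EFin \o f).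
Proof.
move=> mf f1; apply: measurable_bounded_integrable => //.
  by rewrite (le_lt_trans (probability_le1 _ _))// ltry.
exists M; split=> [|A ltA x _ /=]; first exact: num_real.
exact: le_trans (f1 x) (ltW ltA).
Qed.

Lemma Rintegral_cantor (f : R -> R) : measurable_fun [set: measurableTypeR R] f ->
  (forall x, `|f x| <= 1) -> D != fset0 ->
  Rintegral mu setT f =
  #|` D|%:R^-1 * \sum_(d <- D) Rintegral mu setT (fun x => f (phi N d x)).
Proof.
move=> mf f1 D0.
have Dn0 : #|` D|%:R != 0 :> R by rewrite pnatr_eq0 -lt0n cardfs_gt0.
have muT : fine (mu setT) = 1 by rewrite probability_setT.
(* [f + 1] is nonnegative, so the invariance of nonnegative integrals applies to it. *)
pose g x := f x + 1.
have mg : measurable_fun [set: measurableTypeR R] g.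
  by apply: measurable_funD => //; exact: measurable_cst.
have g0 x : 0 <= g x by rewrite -lerBlDr sub0r; have /ler_normlP[] := f1 x; lra.
have intg (h : R -> R) : measurable_fun [set: measurableTypeR R] h -> (forall x, `|h x| <= 1) ->
    Rintegral mu setT (fun x => h x + 1) = Rintegral mu setT h + 1.
  move=> mh h1; rewrite RintegralD//=; last 2 first.
  - exact: (integrable_bounded (M := 1)).
  - by apply: (integrable_bounded (M := 1)) => // x; rewrite normr1.
  by rewrite Rintegral_cst// muT mulr1.
have mfp d : measurable_fun [set: measurableTypeR R] (fun x => f (phi N d x)).
  exact: (measurableT_comp mf (measurable_phi d)).
have : Rintegral mu setT g =
    #|` D|%:R^-1 * \sum_(d <- D) Rintegral mu setT (fun x => g (phi N d x)).
  rewrite /Rintegral ge0_integral_cantor// -EFin_sum_fine// => d _.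
  apply: integrable_fin_num => //; apply: (integrable_bounded (M := 2)) => [|x].
    exact: (measurableT_comp mg (measurable_phi d)).
  by rewrite /g; have := f1 (phi N d x); rewrite !ler_norml; lra.
rewrite intg// (eq_bigr (fun d => Rintegral mu setT (fun x => f (phi N d x)) + 1)); last first.
  by move=> d _; rewrite intg.
rewrite big_split /= big_const_seq count_predT iter_addr_0 mulrDr mulVf//.
exact: addIr.
Qed.

End CantorMeasure.

(** * The exponential [cis] *)

Lemma cisD (R : realType) (s t : R) : cis (s + t) = cis s * cis t.
Proof. by rewrite /cis mulrDr cosD sinD; simpc; congr (_ +i* _)%C; rewrite addrC. Qed.

Lemma cis0 (R : realType) : cis (0 : R) = 1.
Proof. by rewrite /cis mulr0 cos0 sin0. Qed.

Lemma cisN (R : realType) (t : R) : cis (- t) = (cis t)^*.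
Proof. by rewrite /cis mulrN cosN sinN. Qed.

Lemma cisX (R : realType) (t : R) n : cis t ^+ n = cis (t * n%:R).
Proof.
elim: n => [|n IHn]; first by rewrite mulr0 cis0.
by rewrite exprS IHn -cisD -[n.+1]addn1 natrD mulrDr mulr1 addrC.
Qed.

Lemma cis_int (R : realType) (z : int) : cis (z%:~R : R) = 1.
Proof.
have cisn n : cis (n%:R : R) = 1.
  by rewrite -[n%:R]mul1r -cisX /cis mulr1 mulr_natl cos2pi sin2pi expr1n.
case: (intP z) => [|n|n]; rewrite ?cis0//; first exact: cisn.
rewrite intrN cisN (_ : cis _ = 1); last exact: (cisn n.+1).
by rewrite conjC1.
Qed.

(** The fractional part [s] satisfies [cos (2 * pi * s) = 1], so [sin (pi * s)] vanishes by the
    double angle formula; but it is positive for [0 < s < 1]. *)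
Lemma cis_eq1 (R : realType) (t : R) : cis t = 1 -> exists z : int, t = z%:~R.
Proof.
move=> t1; exists (Num.floor t); apply/eqP; rewrite -subr_eq0.
set s := t - _; have s_ge0 : 0 <= s by rewrite subr_ge0 floor_le.
have s_lt1 : s < 1.
  by rewrite ltrBlDl -(intrD _ _ 1); exact: floorD1_gt.
have : cis s = 1 by rewrite cisD cisN t1 cis_int conjC1 mulr1.
rewrite /cis -mulrA mulr_natl cos_mulr2n => -[c2 _].
apply: contraT => s0; have {s0 s_ge0}s0 : 0 < s by rewrite lt_neqAle eq_sym s0.
have : 0 < sin (pi * s).
  apply: sin_gt0_pi; rewrite mulr_gt0 ?pi_gt0//=.
  by rewrite -[ltRHS]mulr1 ltr_pM2l// pi_gt0.
move: (cos2Dsin2 (pi * s)) c2; set c := cos _; set v := sin _; nra.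
Qed.

Lemma Complex_sum (R : realType) (I : Type) (r : seq I) (u v : I -> R) :
  Complex (\sum_(i <- r) u i) (\sum_(i <- r) v i) = \sum_(i <- r) Complex (u i) (v i).
Proof. by elim/big_rec3: _ => // i z y x _ <-; simpc. Qed.

(** * Zeros of the Fourier transform *)

Definition fourier (R : realType) (mu : probability (measurableTypeR R) R) (x : R) : R[i] :=
  cintegral mu (fun y => cis (x * y)).

Section Fourier.
Variables (R : realType) (mu : probability (measurableTypeR R) R).

Lemma measurable_cos_mul (x : R) :
  measurable_fun [set: measurableTypeR R] (fun y : R => cos (2 * pi * (x * y))).
Proof.
have -> : (fun y : R => cos (2 * pi * (x * y))) = cos \o ( *%R (2 * pi * x)).
  by apply/funext => y /=; rewrite mulrA.
apply: measurableT_comp; first (apply: continuous_measurable_fun; exact: continuous_cos).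
by apply: measurable_funM => //; exact: measurable_cst.
Qed.

Lemma measurable_sin_mul (x : R) :
  measurable_fun [set: measurableTypeR R] (fun y : R => sin (2 * pi * (x * y))).
Proof.
have -> : (fun y : R => sin (2 * pi * (x * y))) = sin \o ( *%R (2 * pi * x)).
  by apply/funext => y /=; rewrite mulrA.
apply: measurableT_comp; first (apply: continuous_measurable_fun; exact: continuous_sin).
by apply: measurable_funM => //; exact: measurable_cst.
Qed.

Lemma orthogonal_freqsP (Lambda : set R) : orthogonal_freqs mu Lambda <->
  forall x y, Lambda x -> Lambda y -> x != y -> fourier mu (x - y) = 0.
Proof.
have fE x y : cintegral mu (fun t => freq x t * (freq y t)^*) = fourier mu (x - y).
  congr (cintegral mu _); apply/funext => t.
  by rewrite /freq -cisN -cisD mulrBl.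
split=> orth x y Lx Ly => [/eqP|]xy; first by rewrite -fE orth.
by rewrite fE orth//; exact/eqP.
Qed.

Lemma cintegral_cis_mul (c : R[i]) (x : R) :
  cintegral mu (fun y => c * cis (x * y)) = c * fourier mu x.
Proof.
have ic := integrable_bounded mu (measurable_cos_mul x) (fun y => cos_max _).
have js := integrable_bounded mu (measurable_sin_mul x) (fun y => sin_max _).
have iZ (a : R) (f : R -> R) : mu.-integrable [set: measurableTypeR R] (EFin \o f) ->
    mu.-integrable [set: measurableTypeR R] (EFin \o (fun y => a * f y)).
  by move=> fi; rewrite /comp; under eq_fun do rewrite EFinM; exact: integrableZl.
case: c => a b; rewrite /fourier /cintegral; simpc => /=; congr (_ +i* _)%C.
- under eq_Rintegral do rewrite /cis; simpc.
  by rewrite /= RintegralB ?RintegralZl//; exact: iZ.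
- by rewrite /= RintegralD ?RintegralZl//; exact: iZ.
Qed.

(** Self-similarity replaces [y] by [(y + d) / N], and [cis] splits the result into a constant
    depending on [d] and the integrand at frequency [x / N]. *)
Lemma fourier_scale N (D : {fset nat}) x : is_cantor_measure N D mu -> D != fset0 ->
  fourier mu x = (#|` D|%:R^-1 * \sum_(d <- D) cis (x / N%:R * d%:R)) * fourier mu (x / N%:R).
Proof.
move=> cmu D0; transitivity
  ((#|` D|%:R^-1)%:C%C * \sum_(d <- D) cintegral mu (fun y => cis (x * phi N d y))).
  rewrite /fourier /cintegral -Complex_sum; simpc; rewrite /=.
  congr (_ +i* _)%C.
  - exact: (Rintegral_cantor cmu (measurable_cos_mul x) (fun y => cos_max _) D0).
  - exact: (Rintegral_cantor cmu (measurable_sin_mul x) (fun y => sin_max _) D0).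
rewrite -mulrA mulr_suml fmorphV rmorph_nat; congr (_ * _); apply: eq_bigr => d _.
rewrite -cintegral_cis_mul; congr (cintegral mu _); apply/funext => y.
by rewrite -cisD /phi; congr cis; ring.
Qed.

(** By dominated convergence the real parts at [x / N ^ n] tend to 1, the mass of [mu], so they
    cannot all vanish. *)
Lemma fourier_neq0_near0 N x : (1 < N)%N -> exists n, fourier mu (x / N%:R ^+ n) != 0.
Proof.
move=> N1.
pose f n (y : measurableTypeR R) := (cos (2 * pi * (x / N%:R ^+ n * y)))%:E.
have [] := @dominated_convergence _ _ _ mu setT measurableT f (cst 1%E) (cst 1%E).
- move=> n; apply/measurable_EFinP; exact: measurable_cos_mul.
- exact: measurable_cst.
- apply/aeW => y _.
  have N0 : N%:R != 0 :> R by rewrite pnatr_eq0 -lt0n ltnW.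
  have cv0 : (2 * pi * (x / N%:R ^+ n * y)) @[n --> \oo] --> (0 : R).
    rewrite (_ : (fun n => _) = (fun n => (2 * pi * x * y) * N%:R^-1 ^+ n)); last first.
      by apply/funext => n; rewrite exprVn; ring.
    rewrite -[X in _ --> X](mulr0 (2 * pi * x * y)); apply: cvgMl_tmp; apply: cvg_expr.
    by rewrite normfV normr_nat invf_lt1 ?ltr1n// ltr0n ltnW.
  apply: cvg_EFin; first by exists 0%N.
  rewrite /comp /= -[X in _ --> X]cos0.
  exact: (continuous_cvg _ (@continuous_cos R 0) cv0).
- apply: (integrable_bounded mu (M := 1) (f := cst 1)) => [|y]; first exact: measurable_cst.
  by rewrite normr1.
- by apply/aeW => y n _; rewrite /f /= lee_fin cos_max.
move=> _ _; rewrite integral_cst// mul1e (_ : _ setT = 1%E) => [cvg1|]; last first.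
  exact: probability_setT.
apply: contrapT => F0; have f0 n : (\int[mu]_y f n y = 0)%E.
  have : fine (\int[mu]_y f n y) = 0.
    apply: contrapT => /eqP f0; apply: F0; exists n.
    by rewrite /fourier /cintegral eq_complex negb_and /= f0.
  rewrite -[X in _ -> X = _]fineK; first by move=> ->.
  apply: integrable_fin_num => //.
  exact: (integrable_bounded mu (measurable_cos_mul _) (fun y => cos_max _)).
move: cvg1; rewrite (_ : [sequence _]_n = cst 0%E); last exact/funext.
move=> /cvg_lim; rewrite lim_cst// => /(_ (@ereal_hausdorff R)) /eqP.
by rewrite eqe eq_sym oner_eq0.
Qed.

(** No infinite product is formed: [fourier_scale] is iterated until the remaining transform is
    nonzero, and then one of finitely many mask factors must vanish. *)
Lemma fourier_eq0 N (D : {fset nat}) x : (1 < N)%N -> is_cantor_measure N D mu ->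
  D != fset0 -> fourier mu x = 0 <->
  exists k, \sum_(d <- D) cis (x / N%:R ^+ k.+1 * d%:R) = 0.
Proof.
move=> N1 cmu D0.
have Dn0 : #|` D|%:R != 0 :> R[i] by rewrite pnatr_eq0 -lt0n cardfs_gt0.
have step y : (fourier mu y == 0) =
    (\sum_(d <- D) cis (y / N%:R * d%:R) == 0) || (fourier mu (y / N%:R) == 0).
  by rewrite (fourier_scale y cmu D0) !mulf_eq0 invr_eq0 (negbTE Dn0).
split=> [/eqP F0|[k]].
  have [n] := fourier_neq0_near0 x N1.
  elim: n x F0 => [|n IHn] y; first by rewrite divr1 => ->.
  rewrite step => /orP[/eqP y0 _|/IHn y0]; first by exists 0%N.
  rewrite exprS invfM mulrA => /y0[k yk]; exists k.+1.
  by rewrite exprS invfM mulrA.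
elim: k x => [|k IHk] y yk; apply/eqP; rewrite step; apply/orP; [left|right].
  exact/eqP.
by apply/eqP/IHk; rewrite -mulrA -invfM -exprS.
Qed.

End Fourier.

(** * The mask polynomial *)

Lemma coef_mask_poly (D : {fset nat}) n : (mask_poly D)`_n = (n \in D)%:R.
Proof.
rewrite /mask_poly coef_sum; under eq_bigr do rewrite coefXn.
have [nD|nD] := boolP (n \in D).
  rewrite (big_fsetD1 n)//= eqxx big_seq big1 ?addr0// => d /fsetD1P[/negbTE].
  by rewrite eq_sym => ->.
by rewrite big_seq big1// => d dD; case: eqP nD => // ->; rewrite dD.
Qed.

(** Both sides times [X ^ (p ^ t) - 1] give [X ^ (p ^ t.+1) - 1], since [p ^ t.+1] has one divisor
    more than [p ^ t], namely itself. *)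
Lemma Cyclotomic_pfactor p t : prime p ->
  'Phi_(p ^ t.+1) = \sum_(j < p) 'X^(p ^ t) ^+ j.
Proof.
move=> pp; have p0 := prime_gt0 pp.
have pt0 : 'X^(p ^ t) - 1 != 0 :> {poly int}.
  by rewrite monic_neq0// monicXnsubC// expn_gt0 p0.
apply: (mulfI pt0); rewrite -subrX1 -exprM -expnSr.
rewrite -!prod_Cyclotomic ?expn_gt0 ?p0//.
transitivity (\prod_(d <- (p ^ t.+1)%N :: divisors (p ^ t)) 'Phi_d);
  first by rewrite big_cons mulrC.
apply: perm_big; apply: uniq_perm => [||d].
- rewrite /= divisors_uniq andbT -dvdn_divisors ?expn_gt0 ?p0//.
  by rewrite dvdn_Pexp2l ?prime_gt1// ltnn.
- exact: divisors_uniq.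
rewrite inE -!dvdn_divisors ?expn_gt0 ?p0//; apply/orP/idP => [[/eqP ->//|]|].
  by move=> /dvdn_trans; apply; rewrite dvdn_exp2l.
move=> /(dvdn_pfactor _ _ pp)[m]; rewrite leq_eqVlt => /orP[/eqP -> ->|]; first by left.
by rewrite ltnS => lemt ->; right; rewrite dvdn_exp2l.
Qed.

Section MaskPoly.
Variables (p alpha : nat) (D : {fset nat}).
Hypotheses (p_prime : prime p) (alpha_gt0 : (0 < alpha)%N) (D_neq0 : D != fset0).
Hypothesis D_mod : forall d d' : nat, d \in D -> d' \in D -> d <> d' ->
  d <> d' %[mod p ^ alpha].
Hypothesis D_prod :
  mask_poly D = \big[*%R/1]_(t \in cyclotomic_exponents p D) 'Phi_(p ^ t).

Let T := cyclotomic_exponents p D.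

Lemma mask_poly_neq0 : mask_poly D != 0.
Proof.
have /fset0Pn[d dD] := D_neq0.
apply/eqP => /(congr1 (fun q : {poly int} => q`_d)) /eqP.
by rewrite coef_mask_poly dD coef0.
Qed.

(** The degree [(p - 1) * p ^ t.-1] of the factor is at least [t] and is bounded through the size of
    [mask_poly D]. *)
Lemma finite_cyclotomic_exponents : finite_set T.
Proof.
apply: (@sub_finite_set _ _ `I_(size (mask_poly D)).+1) => [t [t0 dvd]|]; last first.
  exact: finite_II.
rewrite /= ltnS; have := dvdp_leq mask_poly_neq0 dvd.
rewrite size_Cyclotomic totient_pfactor// => /ltnW; apply: leq_trans.
rewrite -{1}(prednK t0) (leq_trans (ltn_expl t.-1 (prime_gt1 p_prime)))//.
by rewrite leq_pmull// -subn1 subn_gt0 prime_gt1.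
Qed.

Lemma mask_poly_prod : mask_poly D = \prod_(t <- fset_set T) 'Phi_(p ^ t).
Proof. by rewrite D_prod fsbig_finite//; exact: finite_cyclotomic_exponents. Qed.

Lemma Cyclotomic_coef_ge0 t n : (0 < t)%N -> 0 <= ('Phi_(p ^ t))`_n.
Proof.
case: t => // t _; rewrite Cyclotomic_pfactor// coef_sum; apply: sumr_ge0 => j _.
by rewrite -exprM coefXn ler0n.
Qed.

Lemma Cyclotomic_at1 t : (0 < t)%N -> ('Phi_(p ^ t)).[1] = p%:R.
Proof.
case: t => // t _; rewrite Cyclotomic_pfactor// horner_sum.
under eq_bigr do rewrite -exprM hornerXn expr1n.
by rewrite sumr_const card_ord.
Qed.

(* If [t > alpha], two exponents of [P_D] differ by [p ^ t.-1], a multiple of [N]. *)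
Lemma cyclotomic_exponents_le t : T t -> (0 < t <= alpha)%N.
Proof.
move=> Tt; have [t0 _] := Tt; rewrite t0 leqNgt; apply/negP => lt_at.
have tT : t \in fset_set T by rewrite in_fset_set ?inE//; exact: finite_cyclotomic_exponents.
have T_gt0 s : s \in fset_set T -> (0 < s)%N.
  by rewrite in_fset_set; [rewrite inE => -[]|exact: finite_cyclotomic_exponents].
pose Q : {poly int} := \prod_(s <- (fset_set T `\ t)%fset) 'Phi_(p ^ s).
have PQ : mask_poly D = 'Phi_(p ^ t) * Q by rewrite mask_poly_prod (big_fsetD1 t).
have Q_ge0 n : 0 <= Q`_n.
  rewrite /Q big_seq; elim/big_rec: _ n => [n|s q sT IHq n]; first by rewrite coef1 ler0n.
  rewrite coefM; apply: sumr_ge0 => k _; rewrite mulr_ge0//.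
  by apply: Cyclotomic_coef_ge0; case/fsetD1P: sT => _ /T_gt0.
(* Nonnegative terms cannot cancel, so the terms [j = 0] and [j = 1] of the product put both [m] and
   [m + p ^ t.-1] in [D]. *)
have [m Qm] : exists m, Q`_m != 0.
  have : Q != 0 by apply: contraNneq mask_poly_neq0; rewrite PQ => ->; rewrite mulr0.
  by rewrite -lead_coef_eq0 lead_coefE => Qm; exists (size Q).-1.
have Pcoef n : (mask_poly D)`_n = \sum_(j < p) ('X^(p ^ t.-1 * j) * Q)`_n.
  rewrite PQ -{1}(prednK t0) Cyclotomic_pfactor// mulr_suml coef_sum.
  by apply: eq_bigr => j _; rewrite exprM.
have term_ge0 n (j : 'I_p) : 0 <= ('X^(p ^ t.-1 * j) * Q)`_n.
  by rewrite coefXnM; case: ifP.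
have Qm_gt0 : 0 < Q`_m by rewrite lt_neqAle eq_sym Qm Q_ge0.
have mem n (j : 'I_p) : 0 < ('X^(p ^ t.-1 * j) * Q)`_n -> n \in D.
  move=> pos; have : 0 < (mask_poly D)`_n.
    by rewrite Pcoef (bigD1 j)//= ltr_wpDr// sumr_ge0.
  by rewrite coef_mask_poly ltr0n lt0b.
have mD : m \in D.
  by apply: (mem _ (Ordinal (prime_gt0 p_prime))); rewrite muln0 mul1r.
have mD' : (m + p ^ t.-1)%N \in D.
  apply: (mem _ (Ordinal (prime_gt1 p_prime))).
  by rewrite muln1 coefXnM ltnNge leq_addl /= addnK.
apply: (D_mod mD mD').
  by apply/eqP; rewrite -[X in X == _]addn0 eqn_add2l eq_sym -lt0n expn_gt0 prime_gt0.
apply/eqP; rewrite -[X in X == _ %[mod _]]addn0 eqn_modDl eq_sym mod0n.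
by apply: dvdn_exp2l; rewrite -ltnS prednK.
Qed.

(** The set of all [alpha * k - t] with [k >= 1] and [t] in [T]: for [0 < t <= alpha], [j] has this
    form exactly when [t = alpha - j %% alpha]. Periodicity is then immediate. *)
Definition zero_positions : pred nat := fun j => `[< T (alpha - j %% alpha)%N >].

(** As [T] lies in [[1, alpha]], the map [j -> alpha - j] is a bijection from the positions below
    [alpha] onto [T]. *)
Lemma big_cyclotomic_exponents (A : Type) (idx : A) (op : Monoid.com_law idx) (F : nat -> A) :
  \big[op/idx]_(t <- fset_set T) F t =
  \big[op/idx]_(j <- iota 0 alpha | zero_positions j) F (alpha - j)%N.
Proof.
transitivity (\big[op/idx]_(t <- [seq (alpha - j)%N | j <- iota 0 alpha & zero_positions j]) F t);
  last by rewrite big_map big_filter.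
apply: perm_big; apply: uniq_perm => [||t]; first exact: fset_uniq.
  rewrite map_inj_in_uniq ?filter_uniq ?iota_uniq// => i j.
  by rewrite !mem_filter !mem_iota /=; lia.
rewrite in_fset_set; last exact: finite_cyclotomic_exponents.
apply/idP/mapP => [|[j]]; rewrite inE.
  move=> Tt; have := cyclotomic_exponents_le Tt => /andP[t0 ta].
  exists (alpha - t)%N; last by rewrite subKn.
  rewrite mem_filter mem_iota /zero_positions modn_small; last by lia.
  by rewrite subKn// asboolT//=; lia.
rewrite mem_filter mem_iota /= add0n => /andP[/asboolP Tj ltj ->].
by rewrite modn_small in Tj.
Qed.

(** Evaluate the factorization of [mask_poly D] at 1, where every factor takes the value [p]. *)
Lemma card_mask : #|` D| = (p ^ count zero_positions (iota 0 alpha))%N.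
Proof.
apply/eqP; rewrite -(eqr_nat int); apply/eqP.
transitivity (mask_poly D).[1].
  rewrite /mask_poly horner_sum; under eq_bigr do rewrite hornerXn expr1n.
  by rewrite big_const_seq count_predT iter_addr_0.
rewrite mask_poly_prod horner_prod big_cyclotomic_exponents big_seq_cond.
rewrite (eq_bigr (fun=> p%:R)) => [|j /andP[]]; last first.
  by rewrite mem_iota /= => ltj _; rewrite Cyclotomic_at1//; lia.
by rewrite -big_seq_cond big_const_seq iter_mulr_1 natrX.
Qed.

(** The sum is [mask_poly D] at [cis x]. Its factor for [t] vanishes there iff [cis x] is a
    primitive root of unity of order [p ^ t]. *)
Lemma mask_sum_eq0 (R : realType) (x : R) :
  \sum_(d <- D) cis (x * d%:R) = 0 <->
  exists t (z : int), [/\ T t, x * (p ^ t)%:R = z%:~R & ~~ (p%:Z %| z)%Z].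
Proof.
have p0 : p%:R != 0 :> R by rewrite pnatr_eq0 -lt0n prime_gt0.
pose ev (q : {poly int}) : R[i] := (map_poly intr q).[cis x].
have ev_Phi t : T t -> ev 'Phi_(p ^ t) = 0 <->
    cis (x * (p ^ t)%:R) = 1 /\ cis (x * (p ^ t.-1)%:R) != 1.
  move=> [t0 _]; rewrite -{1 2}(prednK t0) /ev Cyclotomic_pfactor// rmorph_sum horner_sum.
  under eq_bigr do rewrite rmorphXn /= map_polyXn horner_exp hornerXn cisX.
  (* With [w = cis (x * p ^ t.-1)] the factor is [1 + w + ... + w ^ (p - 1)]: it equals [p] at
     [w = 1] and [(w ^ p - 1) / (w - 1)] elsewhere. *)
  rewrite expnSr natrM mulrA; set w := cis (x * _); rewrite -(cisX _ p) -/w.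
  have [->|w1] := eqVneq w 1.
    rewrite (eq_bigr (fun=> 1)) => [|i _]; last by rewrite expr1n.
    rewrite sumr_const card_ord; split=> [/eqP|[]//].
    by rewrite pnatr_eq0 eqn0Ngt prime_gt0.
  have w1' : w - 1 != 0 by rewrite subr_eq0.
  split=> [s0|[wp _]]; first by split=> //; apply/eqP; rewrite -subr_eq0 subrX1 s0 mulr0.
  by apply/eqP; rewrite -(mulrI_eq0 _ (mulfI w1')) -subrX1 wp subrr.
have -> : \sum_(d <- D) cis (x * d%:R) = \prod_(t <- fset_set T) ev 'Phi_(p ^ t).
  transitivity (ev (mask_poly D)); last by rewrite mask_poly_prod /ev rmorph_prod horner_prod.
  rewrite /ev /mask_poly rmorph_sum horner_sum; apply: eq_bigr => d _.
  by rewrite /= map_polyXn hornerXn cisX.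
split=> [/eqP|[t [z [Tt xz pz]]]].
  rewrite prodf_seq_eq0 => /hasP[t]; rewrite in_fset_set; last exact: finite_cyclotomic_exponents.
  rewrite inE => Tt /eqP/(ev_Phi _ Tt)[/cis_eq1[z xz] nx]; exists t, z; split=> //.
  apply: contra nx => /dvdzP[u zu]; apply/eqP; rewrite -(cis_int _ u); congr cis.
  apply: (mulIf p0); rewrite -mulrA -natrM -expnSr prednK; last by case: Tt.
  by rewrite xz zu intrM.
apply/eqP; rewrite prodf_seq_eq0; apply/hasP; exists t.
  by rewrite in_fset_set ?inE//; exact: finite_cyclotomic_exponents.
apply/eqP/(ev_Phi _ Tt); split; first by rewrite xz cis_int.
apply: contra pz => /eqP/cis_eq1[u xu]; apply/dvdzP; exists u.
apply: (@intr_inj R); rewrite -xz intrM -xu -mulrA -natrM -expnSr prednK//.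
by case: Tt.
Qed.

End MaskPoly.

(** * The Hadamard condition *)

Section MaskVal.
Variables (R : realType) (p alpha : nat) (D : {fset nat}).
Hypotheses (p_prime : prime p) (alpha_gt0 : (0 < alpha)%N) (D_neq0 : D != fset0).
Hypothesis D_mod : forall d d' : nat, d \in D -> d' \in D -> d <> d' ->
  d <> d' %[mod p ^ alpha].
Hypothesis D_prod :
  mask_poly D = \big[*%R/1]_(t \in cyclotomic_exponents p D) 'Phi_(p ^ t).

Let S := zero_positions p alpha D.
Let N := (p ^ alpha)%N.

(** Clearing denominators gives the valuation [j = alpha * k.+1 - t]. As [1 <= t <= alpha], it lies
    in the block of length [alpha] starting at [alpha * k], so [j] determines the scale [k]. *)
Lemma mask_sum_eq0_val (x : R) k :
  \sum_(d <- D) cis (x / N%:R ^+ k.+1 * d%:R) = 0 <->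
  exists j (z : int), [/\ (j %/ alpha)%N = k, S j, x = z%:~R,
    (p%:Z ^+ j %| z)%Z & ~~ (p%:Z ^+ j.+1 %| z)%Z].
Proof.
have p0 m : p%:R ^+ m != 0 :> R by rewrite expf_neq0// pnatr_eq0 -lt0n prime_gt0.
have p0' m : p%:Z ^+ m != 0 by rewrite expf_neq0// eqz_nat -lt0n prime_gt0.
have NE : N%:R ^+ k.+1 = p%:R ^+ (alpha * k.+1) :> R by rewrite /N natrX exprM.
rewrite (mask_sum_eq0 p_prime D_neq0 D_prod) NE; split.
- move=> [t [z [Tt xz pz]]].
  have /andP[t0 ta] := cyclotomic_exponents_le p_prime D_neq0 D_mod D_prod Tt.
  have lt_t : (t <= alpha * k.+1)%N by rewrite (leq_trans ta)// mulnS leq_addr.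
  have jE : (alpha * k.+1 - t)%N = (k * alpha + (alpha - t))%N by nia.
  exists (alpha * k.+1 - t)%N, (p%:Z ^+ (alpha * k.+1 - t) * z); split.
  + by rewrite jE divnMDl// divn_small ?addn0//; lia.
  + rewrite /S /zero_positions jE modnMDl modn_small; last by lia.
    by rewrite subKn//; apply/asboolP.
  + have e : p%:R ^+ (alpha * k.+1) = p%:R ^+ (alpha * k.+1 - t) * p%:R ^+ t :> R.
      by rewrite -exprD subnK.
    by rewrite intrM -xz rmorphXn /= natrX e -pmulrn; field; rewrite !p0.
  + by rewrite dvdz_mulr.
  + by rewrite exprSr dvdz_mul2l.
- move=> [j [z [jk /asboolP Tt xz /dvdzP[u zu] pz]]].
  exists (alpha - j %% alpha)%N, u; split=> //.
    rewrite xz zu intrM rmorphXn /= -pmulrn natrX mulrAC -(mulrA u%:~R) -exprD.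
    have -> : (j + (alpha - j %% alpha) = alpha * k.+1)%N.
      by rewrite {1}(divn_eq j alpha) jk; have := ltn_pmod j alpha_gt0; nia.
    by rewrite mulfK.
  by move: pz; rewrite zu mulrC exprSr dvdz_mul2l.
Qed.

Lemma fourier_eq0_val (mu : probability (measurableTypeR R) R) (x : R) :
  is_cantor_measure N D mu ->
  fourier mu x = 0 <-> exists z : int, x = z%:~R /\ val_in p S z.
Proof.
move=> cmu; have N1 : (1 < N)%N.
  by rewrite -(exp1n alpha) ltn_exp2r// prime_gt1.
rewrite (fourier_eq0 x N1 cmu D_neq0); split.
  by move=> [k /mask_sum_eq0_val[j [z [_ Sj xz dz ndz]]]]; exists z; split=> //; exists j.
move=> [z [xz [j [Sj dz ndz]]]]; exists (j %/ alpha)%N.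
by apply/mask_sum_eq0_val; exists j, z.
Qed.

(** This is the scale [k = 0]: distinct digits differ by a non-multiple of [N], so the valuation is
    below [alpha]. *)
Lemma mask_sum_digit_eq0 (a b : 'I_N) :
  \sum_(d <- D) cis ((a%:Z - b%:Z)%:~R / N%:R * d%:R : R) = 0 <->
  val_in p S (a%:Z - b%:Z).
Proof.
rewrite -{1}[N%:R]expr1; split.
  move=> /mask_sum_eq0_val[j [z [_ Sj /intr_inj <- dz ndz]]]; by exists j.
move=> [j [Sj dz ndz]]; apply/mask_sum_eq0_val; exists j, (a%:Z - b%:Z); split=> //.
apply: divn_small; rewrite ltnNge; apply/negP => lej.
have : (N%:Z %| a%:Z - b%:Z)%Z.
  have -> : N%:Z = p%:Z ^+ alpha by rewrite /N -rmorphXn.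
  by rewrite (dvdz_trans _ dz)// dvdz_exp2l.
rewrite -eqz_mod_dvd !modz_nat eqz_nat !modn_small// => /eqP ab.
by move: ndz; rewrite ab subrr dvdz0.
Qed.

End MaskVal.

(** A one-sided inverse of a square matrix is two-sided, so orthonormality can be tested on the
    columns, which the labels index. *)
Lemma unitarymx_square (C : numClosedFieldType) m n (U : 'M[C]_(m, n)) : m = n ->
  U \is unitarymx <-> (U ^t*)%sesqui *m U = 1%:M.
Proof.
move=> mn; move: U; rewrite {}mn => U; rewrite qualifE.
by split=> [/eqP|] /mulmx1C // ->.
Qed.

(** The inner product of the columns of two labels is the normalized mask sum at their difference
    over [N]; on the diagonal it is 1. *)
Lemma hadamard_tripleP (R : realType) N (D : {fset nat}) (B : {fset int}) : D != fset0 ->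
  hadamard_triple R N [fset Posz d | d in D]%fset B <->
  #|` D| = #|` B| /\ forall b b', b \in B -> b' \in B -> b != b' ->
    \sum_(d <- D) cis ((b - b')%:~R / N%:R * d%:R : R) = 0.
Proof.
move=> D0; rewrite /hadamard_triple; set A := [fset Posz d | d in D]%fset.
have cardA : #|` A| = #|` D|.
  by rewrite card_imfset// => i j [].
have n0 : (#|` D|)%:R != 0 :> R[i] by rewrite pnatr_eq0 -lt0n cardfs_gt0.
have dot (j k : 'I_#|` B|) :
  (((hadamard_mx R N A B)^t*)%sesqui *m hadamard_mx R N A B) j k =
  #|` D|%:R^-1 * \sum_(d <- D) cis (((enum_fset B)`_k - (enum_fset B)`_j)%:~R / N%:R * d%:R).
  rewrite mxE mulr_sumr.
  transitivity (\sum_(a <- A)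
     #|` D|%:R^-1 * cis (((enum_fset B)`_k - (enum_fset B)`_j)%:~R / N%:R * a%:~R : R)).
    rewrite [RHS](big_nth 0) big_mkord; apply: eq_bigr => i _.
    rewrite !mxE rmorphM /= -cisN mulrACA -cisD; congr (_ * cis _).
      rewrite fmorphV /= conj_Creal ?ger0_real ?sqrtC_ge0 ?ler0n//.
      by rewrite -invfM -expr2 sqrtCK cardA.
    by rewrite intrB; ring.
  by rewrite big_imfset//= => i j' _ _ [].
have enumB (j k : 'I_#|` B|) : ((enum_fset B)`_j == (enum_fset B)`_k) = (j == k).
  by rewrite nth_uniq ?fset_uniq.
split=> -[cardB].
  move/(unitarymx_square _ cardB) => U1; split=> [|b b' bB b'B nbb'].
    by rewrite -cardA.
  have ltb : (index b B < #|` B|)%N by rewrite index_mem.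
  have ltb' : (index b' B < #|` B|)%N by rewrite index_mem.
  have := dot (Ordinal ltb') (Ordinal ltb); rewrite U1 /= !nth_index// mxE.
  rewrite -enumB /= !nth_index// eq_sym (negbTE nbb') => /esym/eqP.
  by rewrite mulf_eq0 invr_eq0 (negbTE n0) => /eqP.
move=> B0; have cardAB := etrans cardA cardB; split=> //.
apply/(unitarymx_square _ cardAB).
apply/matrixP => j k; rewrite dot mxE.
have [->|njk] := eqVneq j k.
  rewrite subrr; under eq_bigr do rewrite mul0r mul0r cis0.
  by rewrite big_const_seq count_predT iter_addr_0 mulVf.
by rewrite B0 ?mulr0 ?mem_nth// enumB eq_sym.
Qed.

Lemma child_labelsE N q (L : labeling N q) v :
  child_labels L v = [fset z in [seq Posz (L v i) | i : 'I_q]]%fset.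
Proof.
apply/fsetP => z; rewrite inE /=; apply/imfsetP/mapP => [[i _ ->]|[i _ ->]]; exists i => //.
by rewrite mem_enum.
Qed.

Lemma hadamard_child_labels (R : realType) N (D : {fset nat}) (L : labeling N #|` D|) v :
  D != fset0 ->
  hadamard_triple R N [fset Posz d | d in D]%fset (child_labels L v) <->
  injective (L v) /\ forall i j, L v i != L v j ->
    \sum_(d <- D) cis (((L v i)%:Z - (L v j)%:Z)%:~R / N%:R * d%:R : R) = 0.
Proof.
move=> D0; rewrite hadamard_tripleP// child_labelsE card_fseq.
set s := [seq _ | i : 'I_ _]; have ss : size s = #|` D| by rewrite size_map size_enum_ord.
have in_s z : z \in [fset x in s]%fset <-> exists i, z = Posz (L v i).
  rewrite inE /=; split=> [/mapP[i _ ->]|[i ->]]; first by exists i.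
  by apply/mapP; exists i; rewrite ?mem_enum.
have -> : (#|` D| = size (undup s)) <-> injective (L v).
  rewrite -{1}ss; transitivity (uniq s).
    split=> [e|/undup_id -> //].
    by rewrite -[uniq s]negbK -ltn_size_undup -e ltnn.
  split=> [/injectiveP inj i j ij|inj]; first by apply: inj; rewrite ij.
  by apply/injectiveP => i j [/val_inj/inj].
split=> -[inj h]; split=> //.
  by move=> i j nij; apply: h; [apply/in_s; exists i|apply/in_s; exists j|].
by move=> _ _ /in_s[i ->] /in_s[j ->] nij; apply: h.
Qed.

Lemma Lambda_of_0 N q (L : labeling N q) :
  (exists f, forall n, path_label L [::] f n = 0%N) -> Lambda_of L 0.
Proof. by move=> [f f0]; exists f, 0%N; left; rewrite big_ord0. Qed.

Theorem theorem4p3 (R : realType) (p alpha : nat) (D : {fset nat})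
    (mu : probability (measurableTypeR R) R) :
  prime p -> (1 <= alpha)%N ->
  D != fset0 ->
  (forall d d' : nat, d \in D -> d' \in D -> d <> d' ->
     d <> d' %[mod p ^ alpha]) ->
  is_cantor_measure (p ^ alpha) D mu ->
  mask_poly D = \big[*%R/1]_(t \in cyclotomic_exponents p D) 'Phi_(p ^ t) ->
  (forall Lambda : set R,
     orthogonal_maximal mu Lambda -> Lambda 0 ->
     exists L : labeling (p ^ alpha) #|` D|,
       spectral_labeling R L /\ Lambda = int_embed (Lambda_of L)) /\
  (forall L : labeling (p ^ alpha) #|` D|,
     spectral_labeling R L ->
     orthogonal_maximal mu (int_embed (Lambda_of L)) /\
     (int_embed (Lambda_of L) : set R) 0).

Proof.
move=> p_prime alpha_gt0 D_neq0 D_mod cmu D_prod.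
have p_gt1 := prime_gt1 p_prime.
pose S := zero_positions p alpha D.
have perS j : S (alpha + j)%N = S j by rewrite /S /zero_positions modnDl.
have cardD := card_mask p_prime alpha_gt0 D_neq0 D_mod D_prod.
have orthP (Lambda : set R) : orthogonal_freqs mu Lambda <->
    forall x y, Lambda x -> Lambda y -> x != y ->
      exists z : int, x - y = z%:~R /\ val_in p S z.
  rewrite orthogonal_freqsP; split=> h x y Lx Ly xy;
    by apply/(fourier_eq0_val p_prime alpha_gt0 D_neq0 D_mod D_prod _ cmu)/h.
have hadP (L : labeling (p ^ alpha) #|` D|) v :
    hadamard_triple R (p ^ alpha) [fset Posz d | d in D]%fset (child_labels L v) <->
    injective (L v) /\ forall i j, L v i != L v j ->
      val_in p S ((L v i)%:Z - (L v j)%:Z).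
  rewrite hadamard_child_labels//.
  by split=> -[inj h]; split=> // i j /h
    /(mask_sum_digit_eq0 _ p_prime alpha_gt0 D_neq0 D_mod D_prod).
split.
- move=> Lambda [/orthP orthL maxL] L0.
  pose LZ : set int := [set z | Lambda z%:~R].
  (* Since [0] is in [Lambda], each nonzero frequency [x = x - 0] is an integer by [orthL]. *)
  have LE : Lambda = int_embed LZ.
    apply/seteqP; split=> [x Lx|_ [z Lz <-]]//.
    have [->|x0] := eqVneq x 0; first by exists 0.
    have [z [xz _]] := orthL _ _ Lx L0 x0.
    by rewrite subr0 in xz; exists z => //; rewrite /LZ /= -xz.
  have spacedLZ x y : LZ x -> LZ y -> x != y -> val_in p S (x - y).
    move=> Lx Ly xy; have [|z [+ vz]] := orthL _ _ Lx Ly.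
      by rewrite eqr_int.
    by rewrite -intrB => /intr_inj ->.
  (* Adjoining such a [z] to [Lambda] keeps it orthogonal, so maximality gives [z] in [Lambda]. *)
  have maxLZ z : (forall x, LZ x -> x != z -> val_in p S (z - x)) -> LZ z.
    move=> vz; rewrite /LZ /= -(maxL (Lambda `|` [set z%:~R])) => [|x Lx|].
    + by right.
    + by left.
    have vzx x : Lambda x -> x != z%:~R -> exists w : int,
        z%:~R - x = w%:~R /\ val_in p S w.
      rewrite {1}LE => -[w Lw <-]; rewrite eqr_int => wz.
      by exists (z - w); rewrite intrB; split=> //; exact: vz.
    apply/orthP => x y [Lx|->] [Ly|->] xy.
    + exact: orthL.
    + have [w [zx vw]] := vzx _ Lx xy; exists (- w); rewrite intrN -zx opprB.
      by split=> //; apply/val_inN.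
    + by apply: vzx; rewrite // eq_sym.
    + by rewrite eqxx in xy.
  have [L [sL L0path Lev LZE]] :=
    labeling_of_Lambda p_gt1 alpha_gt0 perS cardD (L0 : LZ 0) spacedLZ maxLZ.
  exists L; split; last by rewrite LE LZE.
  by split=> // v; apply/hadP/sL.
- move=> L [L0path Lev had].
  have sL : @spaced_labeling p alpha _ S L by move=> v; apply/hadP.
  have L0 : (int_embed (Lambda_of L) : set R) 0.
    by exists 0 => //; exact: Lambda_of_0.
  split=> //; split.
    apply/orthP => _ _ [x Lx <-] [y Ly <-]; rewrite eqr_int => xy.
    exists (x - y); rewrite intrB; split=> //.
    exact: (Lambda_of_spaced p_gt1 alpha_gt0 perS sL).
  move=> Lambda' LL' /orthP orthL'; apply/seteqP; split=> // x L'x.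
  have [->//|x0] := eqVneq x 0.
  (* [Lambda'] contains [0], so [x] is an integer and [Lambda_of_maximal] applies to it. *)
  have [z [+ _]] := orthL' _ _ L'x (LL' _ L0) x0; rewrite subr0 => xz.
  exists z => //; apply: (Lambda_of_maximal p_gt1 alpha_gt0 perS cardD sL Lev) => y Ly yz.
  have [||w [+ vw]] := orthL' x y%:~R L'x; first by apply: LL'; exists y.
    by rewrite xz eqr_int eq_sym.
  by rewrite xz -intrB => /intr_inj ->.
Qed.
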